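(* For any choice of $\mu$, the operator $\mathsf{H}_\mu$ is not self-adjoint.
   Context: Let $d\ge 2$ and let $\Omega\subset\mathbb{R}^d$ be a bounded, connected, $C^2$-smooth open set. Let $a\colon\Omega\to M_d(\mathbb{R})$ be a symmetric matrix function with real-valued entries in $C^1(\overline\Omega)$ such that for some $c>0$ one has $\xi\cdot a(x)\xi\ge c|\xi|^2$ for all $\xi\in\mathbb{R}^d$, $x\in\Omega$. Function spaces are complex-valued. Let $\mu$ be a Radon probability measure on $\Omega$ such that $H^2(\Omega)\ni u\mapsto \langle u\rangle_\mu := \int_\Omega u\,d\mu$ is a continuous functional on $H^2(\Omega)$ (''any choice of $\mu$'' ranges over all such measures). Write $\nabla\cdot a\nabla u=\sum_{i,j}\partial_i(a_{ij}\partial_j u)$. In the Hilbert space $L^2(\Omega)$ define the operator $$\mathsf{H}_\mu u := -\nabla\cdot a\nabla u,\qquad \mathrm{dom}\,\mathsf{H}_\mu := \{u\in H^2(\Omega): u|_{\partial\Omega}=\langle u\rangle_\mu\}$$ (the trace of $u$ on $\partial\Omega$ equals the constant $\langle u\rangle_\mu$). *)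

(* Defs.v *)
From HB Require Import structures.
From mathcomp Require Import all_boot all_order all_algebra.
From mathcomp Require Import all_classical all_reals all_analysis.
From mathcomp Require Import measurable_realfun complex.

Set Implicit Arguments.
Unset Strict Implicit.
Unset Printing Implicit Defensive.

Import Order.TTheory GRing.Theory Num.Theory.
Import numFieldNormedType.Exports.

Local Open Scope classical_set_scope.
Local Open Scope ring_scope.

Definition rV_display : measure_display.
Proof. exact. Qed.

Section borel_sigma_algebra.
Variables (R : realType) (d : nat).
Let G := @open 'rV[R]_d.

Let borel0 : <<s G >> set0. Proof. exact: sigma_algebra0. Qed.

Let borelC A : <<s G >> A -> <<s G >> (~` A).
Proof. exact: sigma_algebraC. Qed.

Let borel_bigcup (F : _^nat) :
  (forall i, <<s G >> (F i)) -> <<s G >> (\bigcup_i (F i)).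
Proof. exact: sigma_algebra_bigcup. Qed.

HB.instance Definition _ := @isMeasurable.Build rV_display 'rV[R]_d <<s G >>
  borel0 borelC borel_bigcup.

End borel_sigma_algebra.

Section borel_rV.
Variables (R : realType) (d : nat).

Lemma rV_open_measurable (A : set 'rV[R]_d) : open A -> measurable A.
Proof. by move=> oA; apply: sub_sigma_algebra. Qed.

Lemma rV_continuous_measurable (f : 'rV[R]_d -> R) :
  continuous f -> measurable_fun setT f.
Proof.
move=> /continuousP cf; apply: (measurability _ (RGenOpens.measurableE R)).
move=> _ [_ [a [b ->] <-]]; rewrite setTI; apply: rV_open_measurable.
exact/cf/interval_open.
Qed.

Lemma measurable_coord (i : 'I_d) :
  measurable_fun setT (fun x : 'rV[R]_d => x 0 i).
Proof. by apply: rV_continuous_measurable; exact: coord_continuous. Qed.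

Lemma measurable_to_rV d' (T : measurableType d') (f : T -> 'rV[R]_d) :
  (forall i, measurable_fun setT (fun t => f t 0 i)) -> measurable_fun setT f.
Proof.
move=> mf.
apply: (@measurability _ _ _ _ _ f (@open 'rV[R]_d)) => //.
move=> _ [A oA <-]; rewrite setTI.
pose B (pq : 'rV[rat]_d * 'rV[rat]_d) : set 'rV[R]_d :=
  [set x | forall i, x 0 i \in `]ratr (pq.1 0 i), ratr (pq.2 0 i)[].
pose F pq := if `[< B pq `<=` A >] then f @^-1` B pq else set0.
have -> : f @^-1` A = \bigcup_pq F pq.
  apply/seteqP; split => [t /= Aft|t [pq _]]; last first.
    by rewrite /F; case: asboolP => // BA /BA.
  have /nbhs_ballP[e /= e0 eA] : nbhs (f t) A.
    by apply: open_nbhs_nbhs; split.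
  have lo i : {q : rat | ratr q \in `](f t 0 i - e), (f t 0 i)[}.
    by apply/cid; apply: rat_in_itvoo; rewrite ltrBlDr ltrDl.
  have hi i : {q : rat | ratr q \in `](f t 0 i), (f t 0 i + e)[}.
    by apply/cid; apply: rat_in_itvoo; rewrite ltrDl.
  exists (\row_i sval (lo i), \row_i sval (hi i)) => //.
  rewrite /F; case: asboolP => [_|[]] /=.
    move=> i; rewrite /= !mxE in_itv /=.
    by have /itvP -> := svalP (lo i); have /itvP -> := svalP (hi i).
  move=> x Bx; apply: eA; split => // k i; rewrite ord1.
  move: (Bx i) (svalP (lo i)) (svalP (hi i)).
  rewrite /= !mxE !in_itv /= => /andP[x1 x2] /andP[l1 _] /andP[_ h2].
  rewrite /ball /= distrC ltr_distl.
  by rewrite (lt_trans l1 x1) (lt_trans x2 h2).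
apply: countable_bigcupT_measurable; first exact: countableP.
move=> pq; rewrite /F; case: asboolP => // _.
rewrite (_ : _ @^-1` _ = \bigcap_(i in setT)
    ((fun t => f t 0 i) @^-1` `]ratr (pq.1 0 i), ratr (pq.2 0 i)[%classic)).
  apply: fin_bigcap_measurable => [|i _]; first exact: finite_finset.
  by rewrite -[X in measurable X]setTI; apply: mf.
apply/seteqP; split => t /=; first by move=> H i _; apply: H.
by move=> H i; apply: H.
Qed.

End borel_rV.

Section lebesgue_rV.
Variable R : realType.

Definition cons_rV d (p : R * 'rV[R]_d) : 'rV[R]_d.+1 :=
  row_mx (const_mx p.1 : 'rV_1) p.2.

Definition uncons_rV d (x : 'rV[R]_d.+1) : R * 'rV[R]_d :=
  (x 0 ord0, \row_i x 0 (lift ord0 i)).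

Lemma cons_rVE0 d (p : R * 'rV[R]_d) : cons_rV p 0 ord0 = p.1.
Proof.
have := row_mxEl (const_mx p.1 : 'rV_1) p.2 0 ord0; rewrite [RHS]mxE => <-.
by congr (row_mx _ _ _ _); apply: val_inj.
Qed.

Lemma cons_rVES d (p : R * 'rV[R]_d) i : cons_rV p 0 (lift ord0 i) = p.2 0 i.
Proof.
rewrite -(row_mxEr (const_mx p.1 : 'rV_1) p.2).
by congr (row_mx _ _ _ _); apply: val_inj.
Qed.

Lemma cons_rVK d : cancel (@cons_rV d) (@uncons_rV d).
Proof.
move=> [t x]; rewrite /uncons_rV cons_rVE0; congr (_, _).
by apply/rowP => i; rewrite mxE cons_rVES.
Qed.

Lemma measurable_cons_rV d : measurable_fun setT (@cons_rV d).
Proof.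
apply: measurable_to_rV => i; have [j ->|->] := unliftP ord0 i.
  under eq_fun do rewrite cons_rVES.
  exact: measurableT_comp (measurable_coord j) measurable_snd.
by under eq_fun do rewrite cons_rVE0; exact: measurable_fst.
Qed.

Lemma measurable_uncons_rV d : measurable_fun setT (@uncons_rV d).
Proof.
apply/measurable_fun_pairP; split; first exact: measurable_coord.
apply: measurable_to_rV => i.
rewrite [X in measurable_fun _ X](_ : _ = fun x : 'rV[R]_d.+1 => x 0 (lift ord0 i)).
  exact: measurable_coord.
by apply/funext => x /=; rewrite mxE.
Qed.

Section lebesgue_rVS.
Local Open Scope ereal_scope.
Variables (d : nat) (m : {sigma_finite_measure set 'rV[R]_d -> \bar R}).

Let lebR : {sigma_finite_measure set (measurableTypeR R) -> \bar R} :=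
  lebesgue_measure.

Definition lebesgue_rVS : set 'rV[R]_d.+1 -> \bar R :=
  pushforward (lebR \x m) (@cons_rV d).

Let mcons : measurable_fun setT (@cons_rV d) := @measurable_cons_rV d.

Let preim_measurable (A : set 'rV[R]_d.+1) :
  measurable A -> measurable (@cons_rV d @^-1` A).
Proof. by move=> mA; rewrite -[X in measurable X]setTI; exact: mcons. Qed.

Let lebesgue_rVS0 : lebesgue_rVS set0 = 0.
Proof. by rewrite /lebesgue_rVS /pushforward preimage_set0 measure0. Qed.

Let lebesgue_rVS_ge0 A : 0 <= lebesgue_rVS A.
Proof. exact: measure_ge0. Qed.

Let lebesgue_rVS_sigma_additive : semi_sigma_additive lebesgue_rVS.
Proof.
move=> F mF tF mUF; rewrite /lebesgue_rVS /pushforward preimage_bigcup.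
apply: measure_semi_sigma_additive.
- by move=> n; exact: preim_measurable.
- apply/trivIsetP => /= i j _ _ ij; rewrite -preimage_setI.
  by move/trivIsetP : tF => /(_ _ _ _ _ ij) ->//; rewrite preimage_set0.
- by rewrite -preimage_bigcup; exact: preim_measurable.
Qed.

HB.instance Definition _ := isMeasure.Build _ _ _ lebesgue_rVS
  lebesgue_rVS0 lebesgue_rVS_ge0 lebesgue_rVS_sigma_additive.

Let lebesgue_rVS_sigma_finite : sigma_finite setT lebesgue_rVS.
Proof.
have /sigma_finiteP[F [FT ndF Foo]] := sigma_finiteT lebR.
have /sigma_finiteP[G [GT ndG Goo]] := sigma_finiteT m.
exists (fun k => @uncons_rV d @^-1` (F k `*` G k)).
  rewrite -preimage_bigcup (_ : \bigcup_k _ = setT) ?preimage_setT //.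
  apply/seteqP; split => // -[t x] _.
  have [i _ Fi] : (\bigcup_k F k) t by rewrite -FT.
  have [j _ Gj] : (\bigcup_k G k) x by rewrite -GT.
  exists (maxn i j) => //; split => /=.
    by move: t Fi; exact/subsetPset/ndF/leq_maxl.
  by move: x Gj; exact/subsetPset/ndG/leq_maxr.
move=> k; have [mF Fk] := Foo k; have [mG Gk] := Goo k; split.
  rewrite -[X in measurable X]setTI; apply: measurable_uncons_rV => //.
  exact: measurableX.
rewrite /lebesgue_rVS /pushforward -comp_preimage.
rewrite (_ : _ \o _ = id); last by apply/funext => p /=; rewrite cons_rVK.
by rewrite preimage_id product_measure1E// lte_mul_pinfty// ge0_fin_numE.
Qed.

HB.instance Definition _ := Measure_isSigmaFinite.Build _ _ _ lebesgue_rVS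
  lebesgue_rVS_sigma_finite.

End lebesgue_rVS.

(* Iterated products, starting from the point mass on the one-point space R^0. *)
Fixpoint lebesgue_rV d : {sigma_finite_measure set 'rV[R]_d -> \bar R} :=
  if d is d'.+1 then lebesgue_rVS (lebesgue_rV d')
  else (\d_(0 : 'rV[R]_0) : {sigma_finite_measure set 'rV[R]_0 -> \bar R}).

End lebesgue_rV.

(* A copy of R^d on which every set is measurable: mu_ext asks for covers by
   measurable sets, the Hausdorff premeasure for arbitrary covers. *)
Definition discrete_rV (R : realType) (d : nat) := 'rV[R]_d.

HB.instance Definition _ R d := Pointed.on (discrete_rV R d).
HB.instance Definition _ R d :=
  @isMeasurable.Build default_measure_display (discrete_rV R d)
    (@setT (set (discrete_rV R d))) I (fun _ _ => I) (fun _ _ => I).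

Section hausdorff.
Variables (R : realType) (d : nat).
Local Notation V := 'rV[R]_d.

(* The library norm on 'rV[R]_d is the sup norm. *)
Definition enorm (x : V) : R := Num.sqrt (\sum_i x 0 i ^+ 2).

Local Open Scope ereal_scope.

Definition diam (E : set V) : \bar R :=
  ereal_sup [set r | r = 0 \/
    exists x y, [/\ E x, E y & r = (enorm (x - y))%:E]].

(* Sets of diameter larger than delta are excluded from covers by giving them
   infinite weight. *)
Definition hausdorff_weight (s : nat) (delta : R) (E : set V) : \bar R :=
  if `[< E = set0 >] then 0
  else if diam E <= delta%:E then diam E ^+ s else +oo.

Definition hausdorff_premeasure (s : nat) (delta : R) (A : set V) : \bar R :=
  ereal_inf [set \sum_(k <oo) hausdorff_weight s delta (E k) |
    E in [set E : nat -> set V | A `<=` \bigcup_k E k]].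

(* Without the normalising factor (volume of the unit s-ball) / 2^s, which
   depends on s only. *)
Definition hausdorff (s : nat) (A : set V) : \bar R :=
  ereal_sup [set hausdorff_premeasure s delta A |
    delta in [set delta : R | (0 < delta)%R]].

Lemma diam_ge0 E : 0 <= diam E.
Proof. by apply: ereal_sup_ubound; left. Qed.

Lemma hausdorff_weight0 s delta : hausdorff_weight s delta set0 = 0.
Proof. by rewrite /hausdorff_weight asboolT. Qed.

Lemma hausdorff_weight_ge0 s delta E : 0 <= hausdorff_weight s delta E.
Proof.
rewrite /hausdorff_weight; case: ifP => // _; case: ifP => // _.
exact: expe_ge0 (diam_ge0 E).
Qed.

Lemma hausdorff_premeasureE s delta :
  hausdorff_premeasure s delta =
  mu_ext (hausdorff_weight s delta : set (discrete_rV R d) -> \bar R).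
Proof.
apply/funext => A; rewrite /hausdorff_premeasure /mu_ext; congr ereal_inf.
apply/seteqP; split => [_ [E AE <-]|_ [E [_ AE] <-]].
  by exists E.
by exists E.
Qed.

Lemma hausdorff0 s : hausdorff s set0 = 0.
Proof.
apply/eqP; rewrite eq_le; apply/andP; split.
  apply: ge_ereal_sup => _ [delta _ <-]; rewrite hausdorff_premeasureE mu_ext0 //.
    exact: hausdorff_weight0.
  exact: hausdorff_weight_ge0.
apply: ereal_sup_ubound; exists 1%R => //=.
rewrite hausdorff_premeasureE mu_ext0 //; first exact: hausdorff_weight0.
exact: hausdorff_weight_ge0.
Qed.

Lemma hausdorff_premeasure_ge0 s delta A : 0 <= hausdorff_premeasure s delta A.
Proof.
rewrite hausdorff_premeasureE; apply: mu_ext_ge0; exact: hausdorff_weight_ge0.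
Qed.

Lemma hausdorff_ge0 s A : 0 <= hausdorff s A.
Proof.
apply: le_trans (hausdorff_premeasure_ge0 s 1 A) _.
by apply: ereal_sup_ubound; exists 1%R => //=.
Qed.

Lemma le_hausdorff s : {homo hausdorff s : A B / A `<=` B >-> A <= B}.
Proof.
move=> A B AB; apply: ge_ereal_sup => _ [delta delta0 <-].
apply: (@le_trans _ _ (hausdorff_premeasure s delta B)).
  by rewrite !hausdorff_premeasureE; exact: le_mu_ext.
by apply: ereal_sup_ubound; exists delta.
Qed.

Lemma hausdorff_sigma_subadditive s : sigma_subadditive (hausdorff s).
Proof.
move=> A; apply: ge_ereal_sup => _ [delta delta0 <-].
have := @mu_ext_sigma_subadditive _ (discrete_rV R d) _ _
  (hausdorff_weight_ge0 s delta) A.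
rewrite hausdorff_premeasureE => /le_trans; apply.
apply: lee_nneseries => [k _ _|k _].
  by apply: mu_ext_ge0; exact: hausdorff_weight_ge0.
by rewrite -hausdorff_premeasureE; apply: ereal_sup_ubound; exists delta.
Qed.

HB.instance Definition _ s := isOuterMeasure.Build R V (hausdorff s)
  (hausdorff0 s) (hausdorff_ge0 s) (@le_hausdorff s)
  (@hausdorff_sigma_subadditive s).

Definition hausdorff_outer s : {outer_measure set V -> \bar R} := hausdorff s.

Definition surface_measure :
    {measure set (caratheodory_type (hausdorff_outer d.-1)) -> \bar R} :=
  hausdorff_outer d.-1.

End hausdorff.

Section differentiability.
Variables (R : realType) (d : nat).
Local Notation V := 'rV[R]_d.

Definition partial (i : 'I_d) (f : V -> R) (x : V) : R :=
  'D_(delta_mx 0 i) f x.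

Fixpoint Ck_on (A : set V) (k : nat) (f : V -> R) : Prop :=
  (forall x, A x -> {for x, continuous f}) /\
  if k is k'.+1 then forall i : 'I_d,
    (forall x, A x -> derivable f x (delta_mx 0 i)) /\ Ck_on A k' (partial i f)
  else True.

Definition extends_continuously (Omega : set V) (f : V -> R) : Prop :=
  exists g : V -> R, {within closure Omega, continuous g} /\
    forall x, Omega x -> g x = f x.

Definition C1_closure (Omega : set V) (f : V -> R) : Prop :=
  [/\ Ck_on Omega 1 f, extends_continuously Omega f &
      forall i, extends_continuously Omega (partial i f)].

Definition bnd (Omega : set V) : set V := closure Omega `\` Omega°.

End differentiability.

(* Near each boundary point, Omega is one side of the graph of a C^2 function of
   the remaining coordinates, in the direction of some signed coordinate axis
   (up to relabelling and reorienting the axes; a rotation is never needed, as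
   the normal has some nonzero coordinate). *)
Definition C2_domain (R : realType) (d : nat) (Omega : set 'rV[R]_d) : Prop :=
  forall x0, bnd Omega x0 ->
    exists (k : 'I_d) (s : bool) (gamma : 'rV[R]_d.-1 -> R),
      Ck_on setT 2 gamma /\
      \forall x \near x0, Omega x <-> gamma (col' k x) < (-1) ^+ s * x 0 k.

Section complex_integral.
Context (disp : measure_display) (T : measurableType disp) (R : realType).

Definition cintegral (mu : {measure set T -> \bar R}) (D : set T) (f : T -> R[i]) : R[i] :=
  Complex (\int[mu]_(x in D) complex.Re (f x))%R
          (\int[mu]_(x in D) complex.Im (f x))%R.

End complex_integral.

Section sobolev.
Variables (R : realType) (d : nat) (Omega : set 'rV[R]_d).
Local Notation V := 'rV[R]_d.
Local Notation lam := (lebesgue_rV R d).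
Local Notation normc := Normc.normc.

(* Elements of L^2(Omega) are represented by functions on R^d whose values
   outside Omega are irrelevant. *)
Definition L2 (u : V -> R[i]) : Prop :=
  [/\ measurable_fun Omega (fun x => complex.Re (u x)),
      measurable_fun Omega (fun x => complex.Im (u x)) &
      (\int[lam]_(x in Omega) (normc (u x) ^+ 2)%:E < +oo)%E].

Definition L2_inner (u v : V -> R[i]) : R[i] :=
  cintegral lam Omega (fun x => u x * conjc (v x)).

Definition L2_norm (u : V -> R[i]) : R :=
  Num.sqrt (\int[lam]_(x in Omega) (normc (u x) ^+ 2)).

Definition test_function (phi : V -> R) : Prop :=
  (forall k, Ck_on setT k phi) /\
  exists K : set V, [/\ compact K, K `<=` Omega &
    forall x, ~ K x -> phi x = 0].

Definition weak_partial (i : 'I_d) (u g : V -> R[i]) : Prop :=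
  [/\ L2 u, L2 g & forall phi, test_function phi ->
    cintegral lam Omega (fun x => u x * (partial i phi x)%:C%C) =
    - cintegral lam Omega (fun x => g x * (phi x)%:C%C)].

(* D [:: i1; ...; ij] is the iterated weak derivative of u in the directions
   i1, ..., ij. *)
Definition sobolev_jet (k : nat) (u : V -> R[i])
    (D : seq 'I_d -> V -> R[i]) : Prop :=
  [/\ D [::] = u, L2 u &
      forall s i, (size s < k)%N -> weak_partial i (D s) (D (i :: s))].

Definition sobolev (k : nat) (u : V -> R[i]) : Prop :=
  exists D, sobolev_jet k u D.

(* Jets of u are unique almost everywhere, so the infimum is over a single
   value. *)
Definition sobolev_norm (k : nat) (u : V -> R[i]) : R :=
  inf [set Num.sqrt (\sum_(j < k.+1) \sum_(s : j.-tuple 'I_d) L2_norm (D s) ^+ 2)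
      | D in sobolev_jet k u].

Definition continuous_on_closure (u : V -> R[i]) : Prop :=
  {within closure Omega, continuous (fun x => complex.Re (u x))} /\
  {within closure Omega, continuous (fun x => complex.Im (u x))}.

Definition sobolev_approx (k : nat) (u : V -> R[i])
    (w : nat -> V -> R[i]) : Prop :=
  (forall n, sobolev k (w n) /\ continuous_on_closure (w n)) /\
  sobolev_norm k (w n \- u) @[n --> \oo] --> (0 : R).

(* g is the trace of u: the trace operator H^1(Omega) -> L^2(boundary) is the
   continuous extension of the restriction map on functions continuous up to the
   boundary. *)
Definition has_trace (u g : V -> R[i]) : Prop :=
  sobolev 1 u /\ exists w, sobolev_approx 1 u w /\
    (\int[@surface_measure R d]_(x in bnd Omega) (normc (w n x - g x) ^+ 2)%:E)%E
      @[n --> \oo] --> 0%E.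

Section mean.
Variable mu : probability V R.

Definition radon : Prop :=
  (forall K, compact K -> (mu K < +oo)%E) /\
  forall A, measurable A ->
    mu A = ereal_sup [set mu K | K in [set K | compact K /\ K `<=` A]].

Definition mean_H2_continuous : Prop :=
  exists C : R, forall u, sobolev 2 u -> continuous_on_closure u ->
    normc (cintegral mu Omega u) <= C * sobolev_norm 2 u.

(* The integral of u against mu for u in H^2(Omega), as the continuous extension
   of the integral of functions continuous up to the boundary; mu may be
   singular, so that integrating an arbitrary representative makes no sense. *)
Definition has_mean (u : V -> R[i]) (m : R[i]) : Prop :=
  sobolev 2 u /\ exists w, sobolev_approx 2 u w /\
    normc (cintegral mu Omega (w n) - m) @[n --> \oo] --> (0 : R).

End mean.

(* T u f: u belongs to the domain of T, and T u = f as elements of L^2(Omega). *)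
Definition operator := (V -> R[i]) -> (V -> R[i]) -> Prop.

Definition densely_defined (T : operator) : Prop :=
  forall v, L2 v -> forall e : R, 0 < e ->
    exists u f, T u f /\ L2_norm (v \- u) < e.

Definition adjoint (T : operator) : operator := fun v g =>
  [/\ L2 v, L2 g & forall u f, T u f -> L2_inner f v = L2_inner u g].

Definition self_adjoint (T : operator) : Prop :=
  densely_defined T /\ forall v g, T v g <-> adjoint T v g.

Definition minus_div_a_grad (a : V -> 'M[R]_d) : operator := fun u f =>
  L2 f /\
  exists (p : 'I_d -> V -> R[i]) (q : 'I_d -> 'I_d -> V -> R[i]),
    [/\ forall j, weak_partial j u (p j),
        forall i j, weak_partial i (fun x => (a x i j)%:C%C * p j x) (q i j) &
        {ae lam, forall x, Omega x -> f x = - \sum_i \sum_j q i j x}].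

Definition H_mu (a : V -> 'M[R]_d) (mu : probability V R) : operator :=
  fun u f =>
    [/\ sobolev 2 u,
        exists m, has_mean mu u m /\ has_trace u (cst m) &
        minus_div_a_grad a u f].

End sobolev.

(* Main.v *)
Require Import Defs.
From mathcomp Require Import all_boot all_order all_algebra.
From mathcomp Require Import all_classical all_reals all_analysis.
From mathcomp Require Import measurable_realfun complex ring lra.

Import Order.TTheory GRing.Theory Num.Theory.
Import numFieldNormedType.Exports.

Local Open Scope classical_set_scope.
Local Open Scope ring_scope.

(** The constant function 1 satisfies the boundary condition, because mu is a
    probability measure, and it is annihilated by the operator. If the operator
    were self-adjoint then 1 would be orthogonal to its range, so that
    div(a grad u) would have integral 0 over Omega for every u in the domain
    ([self_adjoint_Rintegral_eq0]). The Gauss formula turns this integral into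
    the conormal flux of u through the boundary, and it remains to find u in the
    domain with nonzero flux.

    Near a boundary point, Omega is the set rho > 0, where rho is the signed
    height over the graph of a C^2 function. The functions u = rho * profile,
    with profile a C^2 function supported in a small window around that point,
    vanish on the boundary, and the density of their inward flux is a positive
    multiple of profile. Take profile = weight * (1 - kappa * rho), where weight
    is the cube of the positive part of a function window. That u has mean 0 is
    one linear condition, met by the choice of kappa, that is, by subtracting
    from rho * weight a multiple of rho^2 * weight, a function without flux.
    This is possible because rho^2 * weight is nonnegative: if its mean is 0,
    then it vanishes almost everywhere for mu, and so does rho * weight
    ([bump_mean_eq0]).

    Traces and surface integrals are avoided as follows. As u vanishes on the
    boundary and is C^2 on the whole space, constant sequences witness its trace
    and its mean ([H_mu_C2]). The flux is computed by inserting a cutoff,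
    a ramp function of n * rho, in front of a grad u: the product has compact
    support in Omega, hence the integral of its divergence is 0
    ([Rintegral_partial_eq0]). The term containing the derivative of the cutoff
    is bounded below, by ellipticity and up to a term that tends to 0, by c times
    the integral of weight against the derivative of the cutoff in the vertical
    direction. One more integration by parts, in that direction only, turns
    the latter into the integral of 6 * posp(window)^2 * rho against the cutoff.
    Letting n tend to infinity gives
      int div(a grad u) + 6 c int posp(window)^2 * rho <= 0
    ([Rintegral_target_le0]), where the second integral is positive, so that the
    first one is not 0 ([Rintegral_div_bump_neq0]). *)

Set Implicit Arguments.
Unset Strict Implicit.
Unset Printing Implicit Defensive.

(** * Functions of class C^k *)

Section Ck.
Variables (R : realType) (d : nat).
Local Notation V := 'rV[R]_d.
Implicit Types (f g : V -> R) (A : set V).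
Local Notation e i := (delta_mx 0 i : V).

Lemma Ck_continuous A k f x : Ck_on A k f -> A x -> {for x, continuous f}.
Proof. by case: k => [|k] [cf _] /cf. Qed.

Lemma Ck_derivable A k f x i : Ck_on A k.+1 f -> A x -> derivable f x (e i).
Proof. by case=> _ /(_ i)[+ _] => /[apply]. Qed.

Lemma Ck_partial A k f i : Ck_on A k.+1 f -> Ck_on A k (partial i f).
Proof. by case=> _ /(_ i)[]. Qed.

Lemma CkS A k f : Ck_on A k.+1 f -> Ck_on A k f.
Proof.
elim: k f => [|k IH] f Cf; (split=> [x|]; first exact: Ck_continuous Cf) => //.
by move=> i; split=> [x|]; [exact: Ck_derivable Cf|apply/IH/Ck_partial].
Qed.

Lemma partial_near_eq i f g x : (\near x, f x = g x) ->
  partial i f x = partial i g x.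
Proof. by move=> fg; exact: near_eq_derive. Qed.

Lemma near_eq_continuous_at f g x : (\near x, f x = g x) ->
  {for x, continuous f} -> {for x, continuous g}.
Proof.
move=> fg cf; rewrite /prop_for /continuous_at -(nbhs_singleton fg).
exact: cvg_trans (near_eq_cvg fg) cf.
Qed.

Lemma Ck_eq A k f g : open A -> (forall x, A x -> f x = g x) ->
  Ck_on A k f -> Ck_on A k g.
Proof.
move=> oA; elim: k f g => [|k IH] f g fg Cf.
  split=> // x Ax; apply: near_eq_continuous_at (Ck_continuous Cf Ax).
  by apply: filterS (open_nbhs_nbhs (conj oA Ax)) => y /fg.
have fgn x : A x -> \near x, f x = g x.
  by move=> Ax; apply: filterS (open_nbhs_nbhs (conj oA Ax)) => y /fg.
split=> [x Ax|i].
  by apply: near_eq_continuous_at (Ck_continuous Cf Ax); exact: fgn.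
split=> [x Ax|].
  exact: (near_eq_derivable (fgn x Ax) (Ck_derivable Cf Ax)).
apply: (IH (partial i f)); last exact: Ck_partial Cf.
by move=> x Ax; apply: partial_near_eq; exact: fgn.
Qed.

Lemma is_derive_partial A k f x i : Ck_on A k.+1 f -> A x ->
  is_derive x (e i) f (partial i f x).
Proof. by move=> Cf Ax; apply: derivableP; exact: Ck_derivable Cf Ax. Qed.

Lemma Ck_cst A k c : Ck_on A k (cst c).
Proof.
elim: k c => [|k IH] c; (split=> [x _|]; first exact: cst_continuous) => //.
move=> i; split=> [x _|]; first exact: derivable_cst.
rewrite (_ : partial i _ = cst 0); first exact: IH.
by apply/funext => x; rewrite /partial derive_cst.
Qed.

Lemma partialD A k f g i x : Ck_on A k.+1 f -> Ck_on A k.+1 g -> A x ->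
  partial i (f \+ g) x = partial i f x + partial i g x.
Proof.
move=> Cf Cg Ax; rewrite /partial deriveD//.
  exact: Ck_derivable Cf Ax.
exact: Ck_derivable Cg Ax.
Qed.

Lemma partialM A k f g i x : Ck_on A k.+1 f -> Ck_on A k.+1 g -> A x ->
  partial i (f \* g) x = partial i f x * g x + f x * partial i g x.
Proof.
move=> Cf Cg Ax; rewrite /partial deriveM//.
- by rewrite addrC [X in X + _]mulrC.
- exact: Ck_derivable Cf Ax.
- exact: Ck_derivable Cg Ax.
Qed.

Lemma CkD A k f g : open A -> Ck_on A k f -> Ck_on A k g -> Ck_on A k (f \+ g).
Proof.
move=> oA; elim: k f g => [|k IH] f g Cf Cg;
  (split=> [x Ax|]; first by
    apply: continuousD; [exact: Ck_continuous Cf Ax|exact: Ck_continuous Cg Ax]) => //.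
move=> i; split=> [x Ax|].
  apply: derivableD; [exact: Ck_derivable Cf Ax|exact: Ck_derivable Cg Ax].
apply: (@Ck_eq _ _ (partial i f \+ partial i g)) => //.
  by move=> x Ax; rewrite (partialD _ Cf Cg).
by apply: IH; exact: Ck_partial.
Qed.

Lemma CkM A k f g : open A -> Ck_on A k f -> Ck_on A k g -> Ck_on A k (f \* g).
Proof.
move=> oA; elim: k f g => [|k IH] f g Cf Cg;
  (split=> [x Ax|]; first by
    apply: continuousM; [exact: Ck_continuous Cf Ax|exact: Ck_continuous Cg Ax]) => //.
move=> i; split=> [x Ax|].
  apply: derivableM; [exact: Ck_derivable Cf Ax|exact: Ck_derivable Cg Ax].
apply: (@Ck_eq _ _ ((partial i f \* g) \+ (f \* partial i g))) => //.
  by move=> x Ax; rewrite (partialM _ Cf Cg).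
by apply: CkD => //; apply: IH; try exact: Ck_partial; exact: CkS.
Qed.

Lemma CkZ A k c f : open A -> Ck_on A k f -> Ck_on A k (fun x => c * f x).
Proof. by move=> oA; apply: CkM => //; exact: Ck_cst. Qed.

Lemma CkN A k f : open A -> Ck_on A k f -> Ck_on A k (fun x => - f x).
Proof.
move=> oA Cf; apply: Ck_eq (CkZ (-1) oA Cf) => // x _; exact: mulN1r.
Qed.

Lemma CkB A k f g : open A -> Ck_on A k f -> Ck_on A k g ->
  Ck_on A k (fun x => f x - g x).
Proof. by move=> oA Cf Cg; exact: (CkD oA Cf (CkN oA Cg)). Qed.

Lemma Ck_sum A k (I : Type) (s : seq I) (P : pred I) (F : I -> V -> R) : open A ->
  (forall j, Ck_on A k (F j)) -> Ck_on A k (fun x => \sum_(j <- s | P j) F j x).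
Proof.
move=> oA CF; rewrite (_ : (fun x => _) = \big[(fun f g => f \+ g)/cst 0]_(j <- s | P j) F j).
  elim/big_ind : _; [exact: Ck_cst| |by []].
  by move=> f g; exact: CkD.
apply/funext => x; elim/big_rec2 : _ => //= i y1 y2 _ ->; done.
Qed.

Lemma partial_coord i j x : partial j (fun y : V => y 0 i) x = (i == j)%:R.
Proof.
rewrite /partial /derive; apply: cvg_lim => //.
apply: (@cvg_trans _ ((cst ((i == j)%:R : R)) @ 0^')); last exact: cvg_cst.
apply: near_eq_cvg; near=> h.
have h0 : h != 0 by near: h; exact: nbhs_dnbhs_neq.
by rewrite /= !mxE eqxx /= addrK /GRing.scale /= mulrA mulVf ?mul1r.
Unshelve. all: by end_near. Qed.

Lemma Ck_coord A k i : Ck_on A k (fun y : V => y 0 i).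
Proof.
case: k => [|k]; (split=> [x _|]; first exact: coord_continuous) => //.
move=> j; split=> [x _|].
  by apply: diff_derivable; exact: differentiable_coord.
rewrite (_ : partial j _ = cst (i == j)%:R); first exact: Ck_cst.
by apply/funext => x; rewrite partial_coord.
Qed.

(** Powers of the positive part are used instead of smooth bump functions: the
    power n.+1 is of class C^n, and all computations with it are polynomial. *)
Definition posp (t : R) : R := Num.max t 0.

Lemma continuous_posp : continuous posp.
Proof. by move=> t; apply: continuous_max; [exact: cvg_id|exact: cvg_cst]. Qed.

Lemma posp_ge0 t : 0 <= posp t. Proof. by rewrite le_max lexx orbT. Qed.

Lemma posp_id t : 0 <= t -> posp t = t.
Proof. by move=> t0; rewrite /posp; apply/max_idPl. Qed.

Lemma posp_eq0 t : t <= 0 -> posp t = 0.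
Proof. by move=> t0; rewrite /posp; apply/max_idPr. Qed.

Lemma is_derive_pospX n (t : R) :
  is_derive t 1 (fun s => posp s ^+ n.+2) (n.+2%:R * posp t ^+ n.+1).
Proof.
have [t0|t0|->] := ltgtP t 0.
- have -> : n.+2%:R * posp t ^+ n.+1 = 0.
    by rewrite (posp_eq0 (ltW t0)) expr0n mulr0.
  apply: (near_eq_is_derive (f := cst 0)).
    near=> s; rewrite /= posp_eq0 ?expr0n//.
    by apply: ltW; near: s; exact: lt_nbhsl.
- rewrite (posp_id (ltW t0)).
  apply: (near_eq_is_derive (f := (id : R -> R) ^+ n.+2 : R -> R)).
    near=> s; have s0 : 0 < s by near: s; exact: lt_nbhsr.
    by rewrite /= exprfctE posp_id// ltW.
  have := @is_deriveX R R id n.+2 t 1 1 (is_derive_id _ _).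
  by rewrite /GRing.scale /= mulr1.
(* At the corner, the difference quotient of the power n.+2 is the power n.+1,
   which is continuous and vanishes there. *)
have p0 : posp 0 = 0 by rewrite posp_id.
have H : (fun h : R => h^-1 *: (((fun s => posp s ^+ n.+2) \o shift 0) (h *: 1)
    - posp 0 ^+ n.+2)) @ 0^' --> posp 0 ^+ n.+1.
  apply: (@cvg_trans _ ((fun h : R => posp h ^+ n.+1) @ 0^')); last first.
    apply/continuous_withinNx => /=.
    apply: (@continuous_comp _ _ _ posp (fun t => t ^+ n.+1)).
      exact: continuous_posp.
    exact: exprn_continuous.
  apply: near_eq_cvg; near=> h.
  have h0 : h != 0 by near: h; exact: nbhs_dnbhs_neq.
  rewrite /= addr0 /GRing.scale /= mulr1 p0 [0 ^+ _]expr0n subr0.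
  have [h1|h1|h1] := ltgtP h 0; last by rewrite h1 eqxx in h0.
    by rewrite posp_eq0 ?(ltW h1)// !expr0n mulr0.
  by rewrite posp_id ?(ltW h1)// [in RHS]exprS mulrA mulVf ?mul1r.
apply: DeriveDef; first by apply/cvg_ex; exists (posp 0 ^+ n.+1); exact: H.
apply: (@etrans _ _ (posp 0 ^+ n.+1)); first by apply: cvg_lim => //; exact: H.
by rewrite p0 expr0n mulr0.
Unshelve. all: by end_near. Qed.

(** The restriction of f to the line through x in the direction v reduces this to
    the chain rule in one variable. *)
Lemma is_derive_chain (U : normedModType R) (f : U -> R) (h : R -> R)
    (x v : U) (df dh : R) :
  is_derive x v f df -> is_derive (f x) 1 h dh ->
  is_derive x v (h \o f) (dh * df).
Proof.
move=> [fx fE] [hx hE].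
have fx1 := (derivable1P _ _ _).1 fx.
have e0 : f (0 *: v + x) = f x by rewrite scale0r add0r.
have hx1 : derivable h ((fun t : R => f (t *: v + x)) 0) 1 by rewrite /= e0.
have D (g : U -> R) : derivable g x v -> 'D_v g x = derive1 (fun t : R => g (t *: v + x)) 0.
  move=> _; rewrite derive1E; apply: (congr1 (fun F : R -> R => lim (F @ 0^'))).
  apply/funext => t /=.
  by rewrite addr0 scale0r add0r [_%:A]mulr1.
have dhf : derivable (h \o f) x v.
  apply/derivable1P; apply/derivable1_diffP.
  by apply: (@differentiable_comp _ _ _ _ (fun t : R => f (t *: v + x)) h);
    apply/derivable1_diffP.
apply: DeriveDef => //.
rewrite D // (derive1_comp fx1 hx1) /= e0 -D // fE; congr (_ * _).
by rewrite derive1E.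
Qed.

Lemma partial_posX A k n f i x : Ck_on A k.+1 f -> A x ->
  is_derive x (e i) (fun y => posp (f y) ^+ n.+2)
    (n.+2%:R * posp (f x) ^+ n.+1 * partial i f x).
Proof.
move=> Cf Ax; apply: (@is_derive_chain _ f (fun t => posp t ^+ n.+2)).
  exact: is_derive_partial Cf Ax.
exact: is_derive_pospX.
Qed.

Lemma Ck_pospX A k n f : open A -> (k <= n)%N -> Ck_on A k f ->
  Ck_on A k (fun y => posp (f y) ^+ n.+1).
Proof.
move=> oA; elim: k n f => [|k IH] n f kn Cf; (split=> [x Ax|]; first
  by apply: (@continuous_comp _ _ _ f (fun t => posp t ^+ n.+1));
    [exact: Ck_continuous Cf Ax|
     apply: (@continuous_comp _ _ _ posp (fun t => t ^+ n.+1));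
     [exact: continuous_posp|exact: exprn_continuous]]) => //.
case: n kn => // n kn i; split=> [x Ax|].
  by have [] := partial_posX n i Cf Ax.
apply: (@Ck_eq _ _ (fun x => n.+2%:R * posp (f x) ^+ n.+1 * partial i f x)) => //.
  by move=> x Ax; have [_ <-] := partial_posX n i Cf Ax.
apply: (@CkM _ _ (fun x => n.+2%:R * posp (f x) ^+ n.+1)) => //; last exact: Ck_partial.
by apply: CkZ => //; apply: IH => //; exact: CkS.
Qed.

Lemma continuous_col' (k : 'I_d) : continuous (fun x : V => col' k x).
Proof.
move=> x A /nbhs_ballP[eps eps0 xA].
apply: filterS (nbhsx_ballx x eps eps0) => y [_ xy].
by apply: xA; split=> // i j; rewrite !mxE; exact: xy.
Qed.

Lemma partial_col' (k : 'I_d) (g : 'rV[R]_d.-1 -> R) x (i : 'I_d) :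
  partial i (fun y : V => g (col' k y)) x =
    'D_(col' k (e i)) g (col' k x).
Proof.
apply: (congr1 (fun F : R -> R => lim (F @ 0^'))); apply/funext => t /=.
by congr (_ *: (g _ - _)); rewrite linearD linearZ.
Qed.

Lemma col'_delta (k : 'I_d) (i : 'I_d) :
  col' k (e i) = (if unlift k i is Some j then delta_mx 0 j else 0) :> 'rV[R]_d.-1.
Proof.
apply/rowP => j; rewrite !mxE; case: unliftP => [j' ->|->]; rewrite !mxE /=.
  by rewrite (inj_eq (@lift_inj _ k)).
by rewrite [lift k j == k]eq_sym (negbTE (neq_lift _ _)).
Qed.

End Ck.

Section Ck_col'.
Variables (R : realType) (d : nat).
Local Notation V := 'rV[R]_d.
Local Notation e i := (delta_mx 0 i : V).

(** The derivative of [col' k] in a coordinate direction is a coordinate direction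
    or 0, so that the derivatives of a composite are again composites. *)
Lemma Ck_col' (k : 'I_d) m (g : 'rV[R]_d.-1 -> R) :
  Ck_on setT m g -> Ck_on setT m (fun y : V => g (col' k y)).
Proof.
elim: m g => [|m IH] g Cg; (split=> [x _|]; first
  by apply: (@continuous_comp _ _ _ (fun x : V => col' k x) g);
    [exact: continuous_col'|exact: Ck_continuous Cg I]) => //.
move=> i; rewrite (_ : partial i _ = fun y : V => 'D_(col' k (e i)) g (col' k y)).
  split=> [x _|].
    suff : derivable g (col' k x) (col' k (e i)).
      move=> /cvg_ex[l gl]; apply/cvg_ex; exists l; apply: cvg_trans gl.
      apply: near_eq_cvg; apply: nearW => t /=.
      by rewrite [col' k (_ + _)]linearP.
    rewrite col'_delta; case: unliftP => [j _|_]; last exact: (@derivable0 _ _ _ g).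
    exact: (Ck_derivable Cg).
  rewrite col'_delta; case: unliftP => [j _|_].
    by apply: (IH (partial j g)); exact: Ck_partial Cg.
  rewrite (_ : (fun y : V => _) = cst 0); first exact: Ck_cst.
  by apply/funext => y; rewrite derive0.
by apply/funext => y; rewrite partial_col'.
Qed.

End Ck_col'.

(** * Lebesgue measure on R^d and integration by parts *)

Section measure.
Variable R : realType.

Lemma lebesgue_ball d (c : 'rV[R]_d) r : 0 < r ->
  lebesgue_rV R d (ball c r) = ((r *+ 2) ^+ d)%:E.
Proof.
move=> r0; elim: d c => [|d IH] c.
  rewrite /= diracE mem_set ?expr0//; split=> // i j; by case: j.
rewrite [LHS](_ : _ = ((lebesgue_measure : {sigma_finite_measure set (measurableTypeR R) -> \bar R})
   \x lebesgue_rV R d)%E (ball (c 0 ord0) r `*` ball (\row_j c 0 (lift ord0 j)) r)); last first.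
  rewrite /= /lebesgue_rVS /pushforward; congr (_ _).
  apply/seteqP; split=> [[t x] [_ H]|[t x] [/= tr [_ xr]]].
    split=> /=; first by have := H 0 ord0; rewrite cons_rVE0.
    split=> // i j; have := H 0 (lift ord0 j).
    by rewrite cons_rVES !mxE !ord1.
  split=> // i j; rewrite !ord1; have [k ->|->] := unliftP ord0 j.
    by rewrite cons_rVES; have := xr 0 k; rewrite mxE.
  by rewrite cons_rVE0.
rewrite product_measure1E//; last 2 first.
  exact: measurable_ball.
  by apply: rV_open_measurable; exact: ball_open.
have -> : lebesgue_rV R d (ball (\row_j c 0 (lift ord0 j)) r) = ((r *+ 2) ^+ d)%:E.
  exact: IH.
rewrite exprS EFinM; congr (_ * _)%E; exact: (lebesgue_measure_ball _ (ltW r0)).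
Qed.

Lemma integrable_bounded_support d (T : measurableType d)
    (mu : {measure set T -> \bar R}) (A : set T) (f : T -> R) :
  measurable A -> (mu A < +oo)%E -> measurable_fun setT f ->
  (exists K : R, forall x, `|f x| <= K) -> (forall x, ~ A x -> f x = 0) ->
  mu.-integrable setT (EFin \o f).
Proof.
move=> mA muA mf [K fK] fA.
suff : mu.-integrable A (EFin \o f).
  move/(integrable_mkcond _ mA); apply: eq_integrable => // x _.
  rewrite /= patchE; case: ifPn => //; rewrite notin_setE => /fA.
  by rewrite /= => ->.
apply: measurable_bounded_integrable => //; first exact: measurable_funTS.
exists K; split; first exact: num_real.
by move=> M KM x _; rewrite /= (le_trans (fK x)) ?(ltW KM).
Qed.

Lemma continuous_support_bounded d (f : 'rV[R]_d -> R) M :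
  continuous f -> (forall x, ~ ball 0 M x -> f x = 0) ->
  exists K : R, forall x, `|f x| <= K.
Proof.
move=> cf f0.
have [M0|M0] := leP M 0.
  exists 0 => x; rewrite f0 ?normr0// => -[]; by rewrite ltNge M0.
have cB : compact (closed_ball (0 : 'rV[R]_d) M).
  apply: bounded_closed_compact; last exact: closed_ball_closed.
  rewrite closed_ballE//; exists M; split; first exact: num_real.
  move=> N MN x; rewrite /closed_ball_ /= sub0r normrN => xM.
  exact: le_trans xM (ltW MN).
have := @continuous_compact _ _ f _ (continuous_subspaceT cf) cB.
move/compact_bounded => -[K [_ KP]].
exists (`|K| + 1) => x.
have [xB|/f0 ->] := pselect (ball 0 M x); last by rewrite normr0 addr_ge0.
apply: (KP (`|K| + 1)); first by rewrite (le_lt_trans (ler_norm K))// ltrDl.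
by exists x => //; exact: subset_closed_ball.
Qed.

Section slice.
Variables (d : nat) (f : 'rV[R]_d.+1 -> R) (M : R).
Hypotheses (cf : continuous f) (f0 : forall x, ~ ball 0 M x -> f x = 0).

Let lebR : {sigma_finite_measure set (measurableTypeR R) -> \bar R} :=
  lebesgue_measure.

Lemma integrable_slice :
  (lebR \x lebesgue_rV R d)%E.-integrable setT (EFin \o (f \o @cons_rV R d)).
Proof.
have [M0|M0] := leP M 0.
  apply: (eq_integrable _ (cst 0%E)) => //; last exact: integrable0.
  move=> x _; rewrite /= f0// => -[]; by rewrite ltNge M0.
apply: (@integrable_bounded_support _ _ (lebR \x lebesgue_rV R d)%E
  (ball 0 M `*` ball 0 M) (f \o @cons_rV R d)).
- apply: measurableX; first exact: measurable_ball.
  by apply: rV_open_measurable; exact: ball_open.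
- have mB : measurable (ball (0 : 'rV[R]_d) M).
    by apply: rV_open_measurable; exact: ball_open.
  have mB1 : measurable (ball (0 : measurableTypeR R) M) by exact: measurable_ball.
  have E := product_measure1E lebR (lebesgue_rV R d) mB1 mB.
  apply: (@eq_ind_r _ _ (fun z => (z < +oo)%E) _ _ E).
  rewrite lebesgue_ball//.
  have E1 : lebR (ball (0 : R) M : set (measurableTypeR R)) = (M *+ 2)%:E.
    exact: (lebesgue_measure_ball _ (ltW M0)).
  apply: (@eq_ind_r _ _ (fun z => (z * ((M *+ 2) ^+ d)%:E < +oo)%E) _ _ E1).
  by rewrite -EFinM ltry.
- apply: measurableT_comp; first exact: rV_continuous_measurable.
  exact: measurable_cons_rV.
- have [K fK] := continuous_support_bounded cf f0.
  by exists K => x; exact: fK.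
- move=> [t x] H; apply: f0 => -[_ xM]; apply: H; split.
    by have := xM 0 ord0; rewrite cons_rVE0 mxE.
  split=> // i j; have := xM 0 (lift ord0 j).
  by rewrite cons_rVES !mxE ord1.
Qed.

Lemma integral_slice1 :
  (\int[lebesgue_rV R d.+1]_x (f x)%:E =
   \int[lebR]_t \int[lebesgue_rV R d]_x (f (cons_rV (t, x)))%:E)%E.
Proof.
apply: etrans; last exact: (esym (integral12_prod_meas1 integrable_slice)).
have := @integral_pushforward _ _ (measurableTypeR R * 'rV[R]_d)%type _ R
  (@cons_rV R d) (@measurable_cons_rV R d)
  (lebR \x lebesgue_rV R d)%E setT (EFin \o f).
rewrite preimage_setT; apply => //; last exact: integrable_slice.
by apply/measurable_EFinP; exact: rV_continuous_measurable.
Qed.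

Lemma integral_slice2 :
  (\int[lebesgue_rV R d.+1]_x (f x)%:E =
   \int[lebesgue_rV R d]_x \int[lebR]_t (f (cons_rV (t, x)))%:E)%E.
Proof. by rewrite integral_slice1 (Fubini integrable_slice). Qed.

End slice.

Lemma integral_derive1_eq0 (g : R -> R) M :
  (forall t, derivable g t 1) -> continuous (fun t => 'D_1 g t) ->
  (forall t, ~ ball 0 M t -> g t = 0) ->
  (forall t, ~ ball 0 M t -> 'D_1 g t = 0) ->
  (\int[lebesgue_measure]_t ('D_1 g t)%:E = 0)%E.
Proof.
move=> dg cg g0 dg0.
have cgg t : {for t, continuous g}.
  exact/differentiable_continuous/derivable1_diffP.
pose N := `|M| + 1.
have out t : N <= `|t| -> ~ ball 0 M t.
  move=> Nt; rewrite -ball_normE /= sub0r normrN; apply/negP; rewrite -leNgt.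
  by rewrite (le_trans _ Nt)// (le_trans (ler_norm M))// lerDl.
have N0 : 0 < N by rewrite ltr_pwDr.
rewrite (_ : (\int[lebesgue_measure]_t ('D_1 g t)%:E =
  \int[lebesgue_measure]_(t in `[(- N)%R, N]) ('D_1 g t)%:E)%E); last first.
  rewrite [RHS]integral_mkcond; apply: eq_integral => t _; rewrite patchE.
  case: ifPn => //; rewrite notin_setE /= in_itv /= => /negP; rewrite -ler_norml.
  by rewrite -ltNge => /ltW /out /dg0 ->.
rewrite (@continuous_FTC2 _ _ g).
- rewrite !g0 ?subee//; apply: out; by rewrite ?normrN ger0_norm // ltW.
- by rewrite (lt_trans _ N0)// oppr_lt0.
- exact: continuous_subspaceT.
- split=> [t _||] //.
    by apply: cvg_at_right_filter; exact: cgg.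
  by apply: cvg_at_left_filter; exact: cgg.
- by move=> t _; rewrite derive1E.
Qed.

Lemma cons_rV_ball d t (x : 'rV[R]_d) M :
  ball 0 M (cons_rV (t, x)) -> ball 0 M t /\ ball 0 M x.
Proof.
move=> [M0 H]; split; first by have := H 0 ord0; rewrite cons_rVE0 mxE.
split=> // i j; have := H 0 (lift ord0 j).
by rewrite cons_rVES !mxE ord1.
Qed.

Lemma cons_rVDZ d h t t' (x x' : 'rV[R]_d) :
  cons_rV (h * t + t', h *: x + x') = h *: cons_rV (t, x) + cons_rV (t', x').
Proof.
apply/rowP => j; have [k ->|->] := unliftP ord0 j.
  by rewrite [RHS]mxE [X in _ = X + _]mxE !cons_rVES /= !mxE.
by rewrite [RHS]mxE [X in _ = X + _]mxE !cons_rVE0.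
Qed.

Lemma cons_rV_delta0 d : cons_rV (1, 0) = delta_mx 0 ord0 :> 'rV[R]_d.+1.
Proof.
apply/rowP => j; have [k ->|->] := unliftP ord0 j.
  by rewrite cons_rVES /= !mxE.
by rewrite cons_rVE0 mxE !eqxx.
Qed.

Lemma cons_rV_deltaS d (i : 'I_d) :
  cons_rV (0, delta_mx 0 i) = delta_mx 0 (lift ord0 i) :> 'rV[R]_d.+1.
Proof.
apply/rowP => j; have [k ->|->] := unliftP ord0 j.
  by rewrite cons_rVES /= !mxE (inj_eq (@lift_inj _ ord0)).
by rewrite cons_rVE0 mxE (negbTE (neq_lift _ _)) andbF.
Qed.

Lemma continuous_cons_rVl d (x : 'rV[R]_d) :
  continuous (fun t : R => cons_rV (t, x)).
Proof.
move=> t A /nbhs_ballP[eps eps0 xA].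
apply: filterS (nbhsx_ballx t eps eps0) => s ts.
apply: xA; split=> // i j; have [k ->|->] := unliftP ord0 j.
  by rewrite !ord1 !cons_rVES; exact: ballxx.
by rewrite !ord1 !cons_rVE0.
Qed.

Lemma continuous_cons_rVr d (t : R) :
  continuous (fun x : 'rV[R]_d => cons_rV (t, x)).
Proof.
move=> x A /nbhs_ballP[eps eps0 xA].
apply: filterS (nbhsx_ballx x eps eps0) => y [_ xy].
apply: xA; split=> // i j; have [k ->|->] := unliftP ord0 j.
  by rewrite !ord1 !cons_rVES; exact: xy.
by rewrite !ord1 !cons_rVE0; exact: ballxx.
Qed.

Lemma derivable_slice d (G : 'rV[R]_d.+1 -> R) (U : normedModType R) (s : U -> 'rV[R]_d.+1)
   (x v : U) w : (forall h, s (h *: v + x) = h *: w + s x) ->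
   (derivable (G \o s) x v <-> derivable G (s x) w) /\
   'D_v (G \o s) x = 'D_w G (s x).
Proof.
move=> E; rewrite /derivable /derive.
rewrite (_ : (fun h => h^-1 *: ((G \o s \o shift x) (h *: v) - (G \o s) x)) =
  (fun h => h^-1 *: ((G \o shift (s x)) (h *: w) - G (s x)))) //.
by apply/funext => h /=; rewrite E.
Qed.

(** By Fubini, it suffices to integrate over slices: if i is the first coordinate,
    the inner integral along it vanishes by the fundamental theorem of calculus,
    otherwise the inner integral over the remaining coordinates vanishes by
    induction on the dimension. *)
Lemma integral_partial_eq0 d (i : 'I_d) (G : 'rV[R]_d -> R) M :
  (forall x, derivable G x (delta_mx 0 i)) -> continuous (partial i G) ->
  (forall x, ~ ball 0 M x -> G x = 0) ->
  (forall x, ~ ball 0 M x -> partial i G x = 0) ->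
  (\int[lebesgue_rV R d]_x (partial i G x)%:E = 0)%E.
Proof.
elim: d i G => [[]//|d IH] i G dG cG G0 dG0.
have [j ij|i0] := unliftP ord0 i.
  rewrite (integral_slice1 cG dG0); apply: integral0_eq => t _.
  have S x h : cons_rV (t, h *: delta_mx 0 j + x) = h *: delta_mx 0 i + cons_rV (t, x).
    by rewrite ij -cons_rV_deltaS -cons_rVDZ mulr0 add0r.
  have PE x : partial j (fun x => G (cons_rV (t, x))) x = partial i G (cons_rV (t, x)).
    exact: (derivable_slice G (S x)).2.
  under eq_integral do rewrite -PE.
  apply: IH.
  - by move=> x; apply: (derivable_slice G (S x)).1.2.
  - rewrite (_ : partial j _ = partial i G \o (fun x => cons_rV (t, x))).
      move=> x; apply: continuous_comp; last exact: cG.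
      exact: continuous_cons_rVr.
    by apply/funext => x; exact: PE.
  - by move=> x xM; apply: G0 => /cons_rV_ball[].
  - by move=> x xM; rewrite PE; apply: dG0 => /cons_rV_ball[].
rewrite (integral_slice2 cG dG0); apply: integral0_eq => x _.
have S t h : cons_rV (h *: 1 + t, x) = h *: delta_mx 0 i + cons_rV (t, x).
  by rewrite i0 -cons_rV_delta0 -cons_rVDZ scaler0 add0r.
have PE t : 'D_1 (fun t => G (cons_rV (t, x))) t = partial i G (cons_rV (t, x)).
  exact: (@derivable_slice _ G R (fun t => cons_rV (t, x)) t 1 _ (S t)).2.
under eq_integral do rewrite -PE.
apply: (@integral_derive1_eq0 _ M).
- move=> t; have := @derivable_slice _ G R (fun t => cons_rV (t, x)) t 1 _ (S t).
  by move=> [[_ +] _]; apply.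
- rewrite (_ : (fun t : R => 'D_1 _ t) = partial i G \o (fun t => cons_rV (t, x))).
    move=> t; apply: continuous_comp; last exact: cG.
    exact: continuous_cons_rVl.
  by apply/funext => t; exact: PE.
- by move=> t tM; apply: G0 => /cons_rV_ball[].
- by move=> t tM; rewrite PE; apply: dG0 => /cons_rV_ball[].
Qed.

End measure.

(** * Weak derivatives on a bounded open set *)

Lemma cintegral_real disp (T : measurableType disp) (R : realType)
    (mu : {measure set T -> \bar R}) (D : set T) (g : T -> R) :
  cintegral mu D (fun x => (g x)%:C%C) = (\int[mu]_(x in D) g x)%:C%C.
Proof.
rewrite /cintegral /=; congr Complex.
by rewrite /Rintegral integral0_eq.
Qed.

Section domain.
Variables (R : realType) (d : nat) (Omega : set 'rV[R]_d).
Local Notation V := 'rV[R]_d.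
Local Notation lam := (lebesgue_rV R d).
Hypotheses (oOmega : open Omega) (bOmega : bounded_set Omega).

Definition bounded_on (f : V -> R) := exists K : R, forall x, Omega x -> `|f x| <= K.

Lemma Ck_measurable k f : Ck_on Omega k f -> measurable_fun Omega f.
Proof.
move=> Cf; apply: (measurability _ (RGenOpens.measurableE R)).
move=> _ [_ [a [b ->] <-]]; apply: rV_open_measurable.
rewrite openE => x [Ox fx]; apply: filterI; first exact: open_nbhs_nbhs.
by apply: (Ck_continuous Cf Ox); apply: open_nbhs_nbhs; split => //.
Qed.

Lemma measurable_Omega : measurable Omega.
Proof. exact: rV_open_measurable. Qed.

Lemma Omega_ball : exists M, Omega `<=` ball 0 M.
Proof.
have [M [_ MP]] := bOmega; exists (`|M| + 2) => x Ox.
rewrite -ball_normE /= sub0r normrN.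
apply: (@le_lt_trans _ _ (`|M| + 1)); last by rewrite ltrD2l ltr1n.
by apply: (MP (`|M| + 1)) => //; rewrite (le_lt_trans (ler_norm M))// ltrDl.
Qed.

Lemma lam_Omega_fin : (lam Omega < +oo)%E.
Proof.
have [M OM] := Omega_ball.
have [M0|M0] := leP M 0.
  rewrite (_ : Omega = set0) ?measure0//.
  by apply/seteqP; split=> // x /OM[]; rewrite ltNge M0.
apply: (@le_lt_trans _ _ (lam (ball 0 M))); last by rewrite lebesgue_ball// ltry.
apply: le_measure => //; rewrite inE; first exact: measurable_Omega.
by apply: rV_open_measurable; exact: ball_open.
Qed.

Lemma integrable_bounded_on f : measurable_fun Omega f -> bounded_on f ->
  lam.-integrable Omega (EFin \o f).
Proof.
move=> mf [K fK]; apply: measurable_bounded_integrable => //.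
- exact: measurable_Omega.
- exact: lam_Omega_fin.
exists K; split; first exact: num_real.
by move=> M KM x Ox; rewrite /= (le_trans (fK x Ox)) ?(ltW KM).
Qed.

Lemma compact_closure_Omega : compact (closure Omega).
Proof.
have [M OM] := Omega_ball.
apply: bounded_closed_compact; last exact: closed_closure.
have : closure Omega `<=` closed_ball 0 M.
  by rewrite /closed_ball; exact: closure_subset.
have [M0|M0] := leP M 0.
  move=> H; exists 0; split => // N N0 x /H.
  rewrite /closed_ball (_ : ball 0 M = set0) ?closure0//.
  by apply/seteqP; split=> // y []; rewrite ltNge M0.
move=> H; exists M; split; first exact: num_real.
move=> N MN x /H; rewrite closed_ballE// /closed_ball_ /= sub0r normrN => xM.
exact: le_trans xM (ltW MN).
Qed.

Lemma extends_bounded f : extends_continuously Omega f -> bounded_on f.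
Proof.
move=> [g [cg gf]].
have /compact_bounded[K [_ KP]] := continuous_compact cg compact_closure_Omega.
exists (`|K| + 1) => x Ox; rewrite -gf//.
apply: (KP (`|K| + 1)); first by rewrite (le_lt_trans (ler_norm K))// ltrDl.
by exists x => //; exact: subset_closure.
Qed.

Lemma continuous_bounded_on f : continuous f -> bounded_on f.
Proof.
move=> cf; apply: extends_bounded; exists f; split => //.
exact: continuous_subspaceT.
Qed.

Lemma bounded_onM f g : bounded_on f -> bounded_on g -> bounded_on (f \* g).
Proof.
move=> [K fK] [L gL]; exists (K * L) => x Ox.
by rewrite normrM ler_pM//; [exact: fK|exact: gL].
Qed.

Lemma bounded_onD f g : bounded_on f -> bounded_on g -> bounded_on (f \+ g).
Proof.
move=> [K fK] [L gL]; exists (K + L) => x Ox.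
by rewrite (le_trans (ler_normD _ _))// lerD//; [exact: fK|exact: gL].
Qed.

Lemma bounded_onN f : bounded_on f -> bounded_on (\- f).
Proof. by move=> [K fK]; exists K => x Ox; rewrite normrN fK. Qed.

Lemma bounded_on_sum (I : Type) (s : seq I) (F : I -> V -> R) :
  (forall j, bounded_on (F j)) -> bounded_on (fun x => \sum_(j <- s) F j x).
Proof.
move=> bF; elim: s => [|j s IH].
  by exists 0 => x _; rewrite big_nil normr0.
have [K HK] := bounded_onD (bF j) IH.
by exists K => x Ox; rewrite big_cons; exact: HK.
Qed.

(** Extending by zero makes a compactly supported function C^1 on the whole
    space, so that no boundary term appears. *)
Lemma Rintegral_partial_eq0 i (f : V -> R) (K : set V) :
  Ck_on Omega 1 f -> compact K -> K `<=` Omega ->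
  (forall x, Omega x -> ~ K x -> f x = 0) ->
  \int[lam]_(x in Omega) partial i f x = 0.
Proof.
move=> Cf cK KO f0.
pose G := f \_ Omega.
have cCK : closed K by apply: compact_closed => //; exact: norm_hausdorff.
have oCK : open (~` K) by rewrite openC.
have GO : Ck_on Omega 1 G.
  by apply: Ck_eq Cf => // x Ox; rewrite /G patchE mem_set.
have G0 x : ~ K x -> G x = 0.
  by move=> Kx; rewrite /G patchE; case: ifPn => // /set_mem Ox; exact: f0.
have GK : Ck_on (~` K) 1 G.
  by apply: (@Ck_eq _ _ _ _ (cst 0)) => //; [move=> x /G0|exact: Ck_cst].
have [M KM] : exists M, K `<=` ball 0 M.
  have [M OM] := Omega_ball; exists M; exact: subset_trans KO OM.
have Gx x : Omega x \/ (~` K) x.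
  by have [/KO|] := pselect (K x); [left|right].
have dG0 x : ~ K x -> partial i G x = 0.
  move=> Kx; rewrite (@partial_near_eq _ _ _ _ (cst 0)).
    by rewrite /partial derive_cst.
  by apply: filterS (open_nbhs_nbhs (conj oCK Kx)) => y /G0.
have := @integral_partial_eq0 R d i G M.
move=> H; rewrite /Rintegral (_ : (\int[lam]_(x in Omega) (partial i f x)%:E = 0)%E)//.
rewrite -{}H.
- rewrite integral_mkcond; apply: eq_integral => x _; rewrite patchE.
  case: ifPn => [/set_mem Ox|]; last first.
    by rewrite notin_setE => Ox; rewrite dG0// => /KO.
  congr EFin; apply: partial_near_eq.
  apply: filterS (open_nbhs_nbhs (conj oOmega Ox)) => y Oy.
  by rewrite /G patchE mem_set.
- by move=> x; have [Ox|Kx] := Gx x; [exact: Ck_derivable GO Ox|exact: Ck_derivable GK Kx].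
- move=> x; have [Ox|Kx] := Gx x.
    exact: (Ck_continuous (Ck_partial i GO) Ox).
  exact: (Ck_continuous (Ck_partial i GK) Kx).
- by move=> x xM; apply: G0 => /KM.
- by move=> x xM; apply: dG0 => /KM.
Qed.

Lemma L2_real f : measurable_fun Omega f -> bounded_on f ->
  L2 Omega (fun x => (f x)%:C%C).
Proof.
move=> mf bf; split=> //=.
rewrite (_ : (fun x => _) = (EFin \o (f \* f))).
  have /integrableP[_] := integrable_bounded_on (measurable_funM mf mf) (bounded_onM bf bf).
  apply: le_lt_trans; apply: ge0_le_integral => //.
  - exact: measurable_Omega.
  - by move=> x _; rewrite lee_fin /= -expr2 sqr_ge0.
  - by apply/measurable_EFinP; exact: measurable_funM.
  - by apply: measurableT_comp => //; apply/measurable_EFinP; exact: measurable_funM.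
  - by move=> x _; rewrite lee_fin /= ler_norm.
by apply/funext => x /=; rewrite expr0n addr0 sqrtr_sqr real_normK ?num_real// expr2.
Qed.

Lemma test_function_bounded phi i : test_function Omega phi ->
  bounded_on phi /\ bounded_on (partial i phi).
Proof.
move=> [Cphi _]; split; apply: continuous_bounded_on => x.
  exact: Ck_continuous (Cphi 0) I.
exact: (Ck_continuous (Ck_partial i (Cphi 1)) I).
Qed.

Lemma Ck_subset (A B : set V) k (f : V -> R) : A `<=` B -> Ck_on B k f -> Ck_on A k f.
Proof.
move=> AB; elim: k f => [|k IH] f [cf H]; split => //; try by move=> x /AB/cf.
move=> i; have [df Cf] := H i; split; last exact: IH.
by move=> x /AB/df.
Qed.

(** The product of f with a test function has compact support in Omega, so that
    its partial derivatives have integral 0; boundedness gives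
    square integrability. *)
Lemma weak_partial_real i f : Ck_on Omega 1 f -> bounded_on f ->
  bounded_on (partial i f) ->
  weak_partial Omega i (fun x => (f x)%:C%C) (fun x => (partial i f x)%:C%C).
Proof.
move=> Cf bf bdf.
have mf := Ck_measurable Cf; have mdf := Ck_measurable (Ck_partial i Cf).
split; [exact: L2_real|exact: L2_real|] => phi tphi.
have [bphi bdphi] := test_function_bounded i tphi.
have [Cphi [K [cK KO phi0]]] := tphi.
have Cphi1 : Ck_on Omega 1 phi by apply: Ck_subset (Cphi 1).
have mphi := Ck_measurable Cphi1.
have mdphi := Ck_measurable (Ck_partial i Cphi1).
have H : \int[lam]_(x in Omega) partial i (f \* phi) x = 0.
  apply: (Rintegral_partial_eq0 i (CkM oOmega Cf Cphi1) cK KO).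
  by move=> x _ /phi0 /= ->; rewrite mulr0.
have E : \int[lam]_(x in Omega) (f x * partial i phi x) =
    - \int[lam]_(x in Omega) (partial i f x * phi x).
  apply/eqP; rewrite eq_sym -subr_eq0 -opprD oppr_eq0 addrC -H.
  rewrite -RintegralD//; first last.
  - by apply: integrable_bounded_on; [exact: measurable_funM|exact: bounded_onM].
  - by apply: integrable_bounded_on; [exact: measurable_funM|exact: bounded_onM].
  - exact: measurable_Omega.
  apply/eqP; apply: eq_Rintegral => x /set_mem Ox.
  by rewrite (partialM _ Cf Cphi1 Ox) addrC.
have P (g h : V -> R) : (fun x => (g x)%:C%C * (h x)%:C%C) = (fun x => (g x * h x)%:C%C).
  by apply/funext => x; rewrite rmorphM.
by rewrite !P !cintegral_real E rmorphN.
Qed.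

End domain.

(** * C^2 functions in the domain of the operator *)

Section sobolev_smooth.
Variables (R : realType) (d : nat) (Omega : set 'rV[R]_d).
Local Notation V := 'rV[R]_d.
Local Notation lam := (lebesgue_rV R d).
Hypotheses (oOmega : open Omega) (bOmega : bounded_set Omega).

Lemma Ck_le (A : set V) m k (f : V -> R) : (m <= k)%N -> Ck_on A k f -> Ck_on A m f.
Proof.
move=> mk; rewrite -(subnK mk); elim: (k - m)%N => [//|n IH]; rewrite addSn.
by move=> /CkS.
Qed.

Lemma Ck_bounded_on k (f : V -> R) : Ck_on setT k f -> bounded_on Omega f.
Proof.
by move=> Cf; apply: continuous_bounded_on => // x; exact: Ck_continuous Cf I.
Qed.

Lemma Ck_foldr_partial k (u : V -> R) (s : seq 'I_d) :
  Ck_on setT k u -> (size s <= k)%N ->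
  Ck_on setT (k - size s) (foldr (@partial R d) u s).
Proof.
move=> Cu; elim: s => [|i s IH] /= sk; first by rewrite subn0.
apply: Ck_partial; rewrite -subSn ?subSS//; exact: IH (ltnW sk).
Qed.

Lemma sobolev_Ck k (u : V -> R) : Ck_on setT k u ->
  sobolev Omega k (fun x => (u x)%:C%C).
Proof.
move=> Cu; exists (fun s x => (foldr (@partial R d) u s x)%:C%C).
have CuO : Ck_on Omega k u by apply: Ck_subset Cu.
split=> //.
  by apply: L2_real => //; [exact: Ck_measurable CuO|exact: Ck_bounded_on Cu].
move=> s i sk.
have Cs : Ck_on setT 1 (foldr (@partial R d) u s).
  by apply: Ck_le (Ck_foldr_partial Cu (ltnW sk)); rewrite subn_gt0.
apply: weak_partial_real => //.
- exact: Ck_subset Cs.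
- exact: Ck_bounded_on Cs.
- exact: Ck_bounded_on (Ck_partial i Cs).
Qed.

(** The norm is an infimum over all jets; the zero jet attains it. *)
Lemma sobolev_norm_subrr k (u : V -> R[i]) : sobolev_norm Omega k (u \- u) = 0.
Proof.
have -> : u \- u = fun x => (cst 0 x : R)%:C%C.
  by apply/funext => x /=; rewrite subrr.
rewrite /sobolev_norm; set S := [set _ | _ in _].
have S0 : S 0.
  have C0 : Ck_on setT k (cst 0 : V -> R) by exact: Ck_cst.
  exists (fun=> fun x => (cst 0 x : R)%:C%C); last first.
    rewrite big1 ?sqrtr0// => j _; rewrite big1// => s _.
    rewrite /L2_norm /Rintegral integral0_eq ?sqrtr0 ?expr0n//.
    by move=> x _ /=; rewrite !expr0n addr0 sqrtr0 expr0n.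
  split=> //; first by have [D []] := sobolev_Ck C0.
  move=> s i sk; have C1 : Ck_on Omega 1 (cst 0 : V -> R) by exact: Ck_cst.
  have pE : partial i (cst 0 : V -> R) = cst 0.
    by apply/funext => x; rewrite /partial derive_cst.
  have b0 : bounded_on Omega (cst 0 : V -> R) by exists 0 => x _; rewrite normr0.
  have := @weak_partial_real R d Omega oOmega bOmega i (cst 0) C1 b0.
  by rewrite pE; exact.
have Sge0 x : S x -> 0 <= x by move=> [D _ <-]; exact: sqrtr_ge0.
apply/eqP; rewrite eq_le; apply/andP; split.
  by apply: ge_inf => //; exists 0 => x /Sge0.
by apply: lb_le_inf; [exists 0|move=> x /Sge0].
Qed.

Lemma sobolev_approx_cst k (u : V -> R) : Ck_on setT k u ->
  sobolev_approx Omega k (fun x => (u x)%:C%C) (fun=> fun x => (u x)%:C%C).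
Proof.
move=> Cu; split=> [_|]; last first.
  by under eq_cvg do rewrite sobolev_norm_subrr; exact: cvg_cst.
split; first exact: sobolev_Ck.
split; last by apply: continuous_subspaceT; exact: cst_continuous.
by apply: continuous_subspaceT => x; exact: Ck_continuous Cu I.
Qed.

Lemma partialM_bounded i (f g : V -> R) :
  Ck_on Omega 1 f -> Ck_on Omega 1 g ->
  bounded_on Omega f -> bounded_on Omega (partial i f) ->
  bounded_on Omega g -> bounded_on Omega (partial i g) ->
  bounded_on Omega (partial i (f \* g)).
Proof.
move=> Cf Cg bf bdf bg bdg.
have [K HK] := bounded_onD (bounded_onM bdf bg) (bounded_onM bf bdg).
by exists K => x Ox; have := HK x Ox; rewrite /= -(partialM _ Cf Cg Ox).
Qed.

Section membership.
Variables (a : V -> 'M[R]_d) (mu : probability V R).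
Hypothesis a_C1 : forall i j, C1_closure Omega (fun x => a x i j).

Definition div_a_grad (u : V -> R) (x : V) : R :=
  \sum_i \sum_j partial i (fun y => a y i j * partial j u y) x.

Lemma a_Ck i j : Ck_on Omega 1 (fun x => a x i j).
Proof. by have [] := a_C1 i j. Qed.

Lemma a_bounded i j : bounded_on Omega (fun x => a x i j).
Proof. by have [_ /(extends_bounded bOmega)] := a_C1 i j. Qed.

Lemma partial_a_bounded k i j : bounded_on Omega (partial k (fun x => a x i j)).
Proof. by have [_ _ /(_ k) /(extends_bounded bOmega)] := a_C1 i j. Qed.

Lemma flux_Ck i j (u : V -> R) : Ck_on setT 2 u ->
  Ck_on Omega 1 (fun x => a x i j * partial j u x).
Proof.
move=> Cu; apply: CkM => //; first exact: a_Ck.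
by apply: Ck_subset (Ck_partial j Cu).
Qed.

Lemma flux_bounded i j (u : V -> R) : Ck_on setT 2 u ->
  bounded_on Omega (fun x => a x i j * partial j u x).
Proof.
move=> Cu; apply: bounded_onM; first exact: a_bounded.
exact: Ck_bounded_on (Ck_partial j Cu).
Qed.

Lemma partial_flux_bounded i j (u : V -> R) : Ck_on setT 2 u ->
  bounded_on Omega (partial i (fun x => a x i j * partial j u x)).
Proof.
move=> Cu; have Cju := Ck_partial j Cu.
have CjuO : Ck_on Omega 1 (partial j u) by apply: Ck_subset Cju.
apply: (@partialM_bounded i (fun x => a x i j) (partial j u)) => //.
- exact: a_Ck.
- exact: a_bounded.
- exact: partial_a_bounded.
- exact: Ck_bounded_on Cju.
- exact: Ck_bounded_on (Ck_partial i Cju).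
Qed.

Lemma div_a_grad_measurable (u : V -> R) : Ck_on setT 2 u ->
  measurable_fun Omega (div_a_grad u).
Proof.
move=> Cu; apply: measurable_sum => i; apply: measurable_sum => j.
exact: Ck_measurable (Ck_partial i (flux_Ck i j Cu)).
Qed.

Lemma div_a_grad_bounded (u : V -> R) : Ck_on setT 2 u ->
  bounded_on Omega (div_a_grad u).
Proof.
move=> Cu; apply: bounded_on_sum => i.
by apply: (@bounded_on_sum _ _ _ _ _
  (fun j => partial i (fun y => a y i j * partial j u y))) => j;
  exact: partial_flux_bounded.
Qed.

(** The constant sequence is an approximation of u in every Sobolev norm, and the
    surface integral in the definition of the trace has a zero integrand. *)
Lemma H_mu_C2 (u : V -> R) : Ck_on setT 2 u ->
  (forall x, bnd Omega x -> u x = \int[mu]_(x in Omega) u x) ->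
  H_mu Omega a mu (fun x => (u x)%:C%C) (fun x => (- div_a_grad u x)%:C%C).
Proof.
move=> Cu ubnd; split; first exact: sobolev_Ck.
  exists (\int[mu]_(x in Omega) u x)%:C%C; split.
    split; first exact: sobolev_Ck.
    exists (fun=> fun x => (u x)%:C%C); split; first exact: sobolev_approx_cst.
    under eq_cvg do rewrite cintegral_real subrr /= expr0n addr0 sqrtr0.
    exact: cvg_cst.
  split; first exact: sobolev_Ck (CkS Cu).
  exists (fun=> fun x => (u x)%:C%C); split; first exact: sobolev_approx_cst (CkS Cu).
  rewrite (_ : (fun n : nat => _) = cst 0%E); first exact: cvg_cst.
  apply/funext => n; apply: integral0_eq => x /ubnd -> /=.
  by rewrite !subrr expr0n addr0 sqrtr0 expr0n.
split.
  apply: L2_real => //.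
    by apply: measurableT_comp => //; exact: div_a_grad_measurable.
  by apply: bounded_onN; exact: div_a_grad_bounded.
exists (fun j x => (partial j u x)%:C%C),
  (fun i j x => (partial i (fun y => a y i j * partial j u y) x)%:C%C); split.
- move=> j; apply: weak_partial_real => //; first by apply: Ck_subset (CkS Cu).
    exact: Ck_bounded_on Cu.
  exact: Ck_bounded_on (Ck_partial j Cu).
- move=> i j; rewrite (_ : (fun x => _ * _) =
    (fun x => (a x i j * partial j u x)%:C%C)); last first.
    by apply/funext => x; rewrite rmorphM.
  apply: weak_partial_real => //; [exact: flux_Ck|exact: flux_bounded|].
  exact: partial_flux_bounded.
- apply: aeW => x _; rewrite rmorphN rmorph_sum; congr (- _).
  by apply: eq_bigr => i _; rewrite rmorph_sum.
Qed.

(** The constant 1 lies in the domain with image 0. As the operator is contained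
    in its adjoint, the images of all other elements are orthogonal to 1. *)
Lemma self_adjoint_Rintegral_eq0 (u : V -> R) : mu Omega = 1%E ->
  self_adjoint Omega (H_mu Omega a mu) -> Ck_on setT 2 u ->
  (forall x, bnd Omega x -> u x = \int[mu]_(x in Omega) u x) ->
  \int[lam]_(x in Omega) div_a_grad u x = 0.
Proof.
move=> muO [_ sa] Cu ubnd.
have C1 : Ck_on setT 2 (cst 1 : V -> R) by exact: Ck_cst.
have T1 := H_mu_C2 C1.
have {}T1 : H_mu Omega a mu (fun x => ((cst 1 : V -> R) x)%:C%C)
    (fun x => (- div_a_grad (cst 1) x)%:C%C).
  apply: T1 => x _; rewrite Rintegral_cst; last exact: measurable_Omega.
  by rewrite mul1r; apply: esym; exact: (congr1 fine muO).
have [_ _ /(_ _ _ (H_mu_C2 Cu ubnd))] := (sa _ _).1 T1.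
have -> : div_a_grad (cst 1) = cst 0.
  apply/funext => x; rewrite /div_a_grad big1// => i _; rewrite big1// => j _.
  rewrite (_ : (fun y => _) = cst 0); first by rewrite /partial derive_cst.
  by apply/funext => y; rewrite /partial derive_cst mulr0.
rewrite /L2_inner.
rewrite (_ : (fun x => _ * _) = (fun x => (- div_a_grad u x)%:C%C)); last first.
  by apply/funext => x; rewrite /= oppr0; exact: mulr1.
rewrite [in X in _ = X](_ : (fun x => _ * _) = (fun x => (cst 0 x : R)%:C%C)); last first.
  by apply/funext => x; rewrite /= !oppr0; exact: mulr0.
rewrite !cintegral_real => -[]; rewrite [X in _ = X]/Rintegral integral0_eq//= => H.
apply: oppr_inj; rewrite oppr0 -H -mulN1r -RintegralZl//.
- by apply: eq_Rintegral => x _; rewrite mulN1r.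
- exact: measurable_Omega.
apply: integrable_bounded_on => //; first exact: div_a_grad_measurable.
exact: div_a_grad_bounded.
Qed.

End membership.
End sobolev_smooth.

(** * A piecewise quadratic ramp *)

Section ramp.
Variable R : realType.
Implicit Type t : R.

(** A quadratic spline of class C^1 that increases from 0 at t = 0 to 1 at t = 2
    and is constant elsewhere; [tent] is its derivative. *)
Definition ramp t : R :=
  (posp t ^+ 2 - 2 * posp (t - 1) ^+ 2 + posp (t - 2) ^+ 2) / 2.

Definition tent t : R := posp t - 2 * posp (t - 1) + posp (t - 2).

Lemma pospE t : posp t = if 0 <= t then t else 0.
Proof. by case: ifPn => [/posp_id //|]; rewrite -ltNge => /ltW/posp_eq0. Qed.

Lemma ramp_le0 t : t <= 0 -> ramp t = 0.
Proof. by move=> t0; rewrite /ramp !posp_eq0; lra. Qed.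

Lemma tent_le0 t : t <= 0 -> tent t = 0.
Proof. by move=> t0; rewrite /tent !posp_eq0; lra. Qed.

Lemma ramp_ge2 t : 2 <= t -> ramp t = 1.
Proof. by move=> t2; rewrite /ramp !posp_id; [field|lra..]. Qed.

Lemma tent_ge2 t : 2 <= t -> tent t = 0.
Proof. by move=> t2; rewrite /tent !posp_id; [ring|lra..]. Qed.

Lemma tent_itv t : 0 <= tent t <= 1.
Proof.
rewrite /tent !pospE; case: (lerP 0 t); case: (lerP 0 (t - 1)); case: (lerP 0 (t - 2)); lra.
Qed.

Lemma ramp_itv t : 0 <= ramp t <= 1.
Proof.
rewrite /ramp !pospE; case: (lerP 0 t); case: (lerP 0 (t - 1));
  case: (lerP 0 (t - 2)) => *; nra.
Qed.

Lemma is_derive_ramp t : is_derive t 1 ramp (tent t).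
Proof.
pose A s : R -> R := fun t => posp (t - s) ^+ 2.
have P s : is_derive t 1 (A s) (2 * posp (t - s)).
  rewrite -[2 * _]mulr1.
  apply: (@is_derive_chain R R (fun t => t - s) (fun t => posp t ^+ 2)).
    exact: (@is_derive_eq _ _ _ _ _ _ _ _
      (is_deriveB (is_derive_id _ _) (is_derive_cst _ _ _)) (subr0 _)).
  by have := is_derive_pospX 0 (t - s); rewrite expr1.
have -> : ramp = 2^-1 *: (A 0 - 2 *: A 1 + A 2).
  by apply/funext => y; rewrite /ramp mulrC -[y in posp y ^+ 2 - _]subr0.
apply: (is_derive_eq (is_deriveZ 2^-1
  (is_deriveD (is_deriveB (P 0) (is_deriveZ 2 (P 1))) (P 2)))).
by rewrite /tent /GRing.scale /= subr0; field.
Qed.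

Lemma continuous_tent : continuous tent.
Proof.
have P (s : R) : continuous (fun t : R => posp (t - s)).
  move=> t; have H1 : {for t, continuous (fun y : R => y - s)}.
    by apply: cvgB; [exact: cvg_id|exact: cvg_cst].
  exact: (continuous_comp H1 (@continuous_posp R (t - s))).
move=> t; apply: cvgD; last exact: P.
apply: cvgB; first exact: continuous_posp.
by apply: cvgM; [exact: cvg_cst|exact: P].
Qed.

End ramp.

(** * Bump functions at the boundary *)

Lemma Rintegral_le0_ae_eq disp (T : measurableType disp) (R : realType)
    (mu : {measure set T -> \bar R}) (D : set T) (f : T -> R) :
  measurable D -> mu.-integrable D (EFin \o f) -> (forall x, D x -> 0 <= f x) ->
  \int[mu]_(x in D) f x <= 0 -> ae_eq mu D (EFin \o f) (cst 0%E).
Proof.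
move=> mD intf f0 If; apply: (ae_eq_integral_abs mu mD _).1.
  by have /integrableP[] := intf.
have -> : (\int[mu]_(x in D) `|(EFin \o f) x| = \int[mu]_(x in D) (f x)%:E)%E.
  by apply: eq_integral => x /set_mem Dx; rewrite /= ger0_norm ?f0.
rewrite -(fineK (integrable_fin_num mD intf)); congr EFin; apply/eqP.
by rewrite eq_le If Rintegral_ge0.
Qed.

Section patch.
Variables (R : realType) (d : nat) (Omega : set 'rV[R]_d).
Local Notation V := 'rV[R]_d.
Local Notation lam := (lebesgue_rV R d).
Local Notation e i := (delta_mx 0 i : V).
Hypotheses (oOmega : open Omega) (bOmega : bounded_set Omega).

Variables (k : 'I_d) (s : bool) (gamma nq : 'rV[R]_d.-1 -> R) (r kappa : R).
Hypotheses (Cgamma : Ck_on setT 2 gamma) (Cnq : Ck_on setT 2 nq).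

(** The signed height above the graph of gamma; near a boundary point Omega is
    the set where it is positive. *)
Definition rho (x : V) : R := (-1) ^+ s * x 0 k - gamma (col' k x).

(** If nq is the squared distance to a point, then in the coordinates [col' k x]
    and [rho x] the set where [window] is positive is a ball of radius r. Using
    rho rather than the coordinate k makes [window] decrease as the height above
    the graph increases, so that the derivative of [weight] in the vertical
    direction has a constant sign on Omega ([partial_weight]). *)
Definition window (x : V) : R := r ^+ 2 - nq (col' k x) - rho x ^+ 2.

Definition weight (x : V) : R := posp (window x) ^+ 3.

(** The parameter kappa changes neither the boundary values nor the flux of
    [bump], and is used to adjust its mean. *)
Definition profile : V -> R := weight \* (fun x => 1 - kappa * rho x).

Definition bump : V -> R := rho \* profile.

Hypothesis window_graph : forall x, 0 <= window x ->
  \forall y \near x, Omega y <-> 0 < rho y.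

Lemma Ck_rho : Ck_on setT 2 rho.
Proof.
apply: CkB; [exact: openT| |exact: Ck_col'].
by apply: CkZ; [exact: openT|exact: Ck_coord].
Qed.

Lemma Ck_window : Ck_on setT 2 window.
Proof.
apply: CkB; [exact: openT| |exact: (CkM openT Ck_rho Ck_rho)].
by apply: CkB; [exact: openT|exact: Ck_cst|exact: Ck_col'].
Qed.

Lemma Ck_weight : Ck_on setT 2 weight.
Proof. by apply: Ck_pospX => //; [exact: openT|exact: Ck_window]. Qed.

Lemma Ck_profile : Ck_on setT 2 profile.
Proof.
apply: CkM; [exact: openT|exact: Ck_weight|].
apply: CkB; [exact: openT|exact: Ck_cst|].
by apply: CkZ; [exact: openT|exact: Ck_rho].
Qed.

Lemma Ck_bump : Ck_on setT 2 bump.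
Proof. by apply: CkM; [exact: openT|exact: Ck_rho|exact: Ck_profile]. Qed.

Lemma partial_col'_eq0 (g : 'rV[R]_d.-1 -> R) x :
  partial k (fun y : V => g (col' k y)) x = 0.
Proof. by rewrite partial_col' col'_delta unlift_none (@derive0 _ _ _ g). Qed.

Lemma is_derive_rho x : is_derive x (e k) rho ((-1) ^+ s).
Proof.
have D1 := is_derive_partial k (Ck_coord setT 2 k) (I : setT x).
have D2 := is_derive_partial k (Ck_col' k Cgamma) (I : setT x).
apply: (is_derive_eq (is_deriveB (is_deriveZ ((-1) ^+ s) D1) D2)).
by rewrite partial_col'_eq0 partial_coord eqxx subr0 /GRing.scale /= mulr1.
Qed.

Lemma partial_rho x : partial k rho x = (-1) ^+ s.
Proof. by have [_ <-] := is_derive_rho x. Qed.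

Lemma partial_window x : partial k window x = - (2 * rho x * (-1) ^+ s).
Proof.
have D2 := is_derive_partial k (Ck_col' k Cnq) (I : setT x).
have D3 := is_deriveM (is_derive_rho x) (is_derive_rho x).
suff [_ <-] : is_derive x (e k) window (- (2 * rho x * (-1) ^+ s)) by [].
apply: (is_derive_eq (is_deriveB (is_deriveB (is_derive_cst (r ^+ 2) x (e k)) D2) D3)).
by rewrite partial_col'_eq0 /GRing.scale /=; ring.
Qed.

Lemma weight_ge0 x : 0 <= weight x.
Proof. by rewrite exprn_ge0// posp_ge0. Qed.

(** The first term is the gradient at the boundary; the second one is a multiple
    of rho, negligible in the flux. *)
Lemma partial_bump j x : partial j bump x =
  weight x * partial j rho x +
  rho x * (partial j profile x - kappa * weight x * partial j rho x).
Proof.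
rewrite (partialM j (CkS Ck_rho) (CkS Ck_profile) (I : setT x)).
by rewrite /profile /=; ring.
Qed.

Lemma partial_weight x :
  partial k weight x = - (6 * posp (window x) ^+ 2 * rho x * (-1) ^+ s).
Proof.
have [_ E] := partial_posX 1 k (CkS Ck_window) (I : setT x).
by rewrite [LHS]E partial_window; ring.
Qed.

Lemma continuous_rho : continuous rho.
Proof. by move=> x; exact: Ck_continuous Ck_rho I. Qed.

Lemma continuous_window : continuous window.
Proof. by move=> x; exact: Ck_continuous Ck_window I. Qed.

Lemma near_window_lt0 x : window x < 0 -> \forall y \near x, window y < 0.
Proof. by move=> wx; exact: (@continuous_window x _ (lt_nbhsl wx)). Qed.

Lemma weight_eq0 x : window x <= 0 -> weight x = 0.
Proof. by move=> wx; rewrite /weight posp_eq0// expr0n. Qed.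

Lemma profile_eq0 x : window x <= 0 -> profile x = 0.
Proof. by move=> wx; rewrite /profile /= weight_eq0// mul0r. Qed.

Lemma bump_eq0 x : window x <= 0 -> bump x = 0.
Proof. by move=> wx; rewrite /bump /= profile_eq0// mulr0. Qed.

Lemma partial_locally0 (f : V -> R) i x :
  (forall y, window y <= 0 -> f y = 0) -> window x < 0 -> partial i f x = 0.
Proof.
move=> f0 /near_window_lt0 wx; rewrite (@partial_near_eq _ _ _ _ (cst 0)).
  by rewrite /partial derive_cst.
by apply: filterS wx => y /ltW /f0.
Qed.

Lemma window_Omega x : 0 <= window x -> Omega x <-> 0 < rho x.
Proof. by move/window_graph/nbhs_singleton. Qed.

(** Either x is outside of the window, or the graph passes through x. *)
Lemma bump_bnd x : bnd Omega x -> bump x = 0.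
Proof.
move=> [clx nOi]; have nOx : ~ Omega x.
  by move=> Ox; apply: nOi; exact: (open_nbhs_nbhs (conj oOmega Ox)).
have [w0|w0] := leP (window x) 0; first exact: bump_eq0.
have nx := window_graph (ltW w0).
rewrite /bump /= (_ : rho x = 0) ?mul0r//; apply/eqP; rewrite eq_le.
apply/andP; split; first by rewrite leNgt; apply/negP => /(window_Omega (ltW w0)).
rewrite leNgt; apply/negP => r0.
have nr : \forall y \near x, rho y < 0.
  exact: (@continuous_rho x _ (lt_nbhsl r0)).
have [y [Oy [yr]]] := clx _ (filterI nx nr).
by apply/negP; rewrite -leNgt ltW//; exact/yr.
Qed.

Section mean.
Variable mu : probability V R.

Lemma integrable_prob_Ck n (f : V -> R) : Ck_on setT n f ->
  mu.-integrable Omega (EFin \o f).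
Proof.
move=> Cf; apply: measurable_bounded_integrable.
- exact: measurable_Omega.
- by rewrite (le_lt_trans (probability_le1 mu _)) ?ltry//; exact: measurable_Omega.
- by apply: (@Ck_measurable _ _ _ oOmega n); apply: Ck_subset Cf.
have [K fK] := Ck_bounded_on bOmega Cf.
exists K; split; first exact: num_real.
by move=> M KM x Ox; rewrite /= (le_trans (fK x Ox)) ?(ltW KM).
Qed.

Let u1 := rho \* weight.
Let u2 := rho \* u1.

Let Cu1 : Ck_on setT 2 u1.
Proof. by apply: CkM; [exact: openT|exact: Ck_rho|exact: Ck_weight]. Qed.

Let Cu2 : Ck_on setT 2 u2.
Proof. by apply: CkM; [exact: openT|exact: Ck_rho|exact: Cu1]. Qed.

(** If the mean of u2 is 0 then kappa = 0, as x / 0 = 0. Then u2 = 0 almost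
    everywhere since it is nonnegative, which forces u1 = 0 almost everywhere. *)
Lemma bump_mean_eq0 :
  kappa = (\int[mu]_(x in Omega) u1 x) / (\int[mu]_(x in Omega) u2 x) ->
  \int[mu]_(x in Omega) bump x = 0.
Proof.
have mO : measurable Omega by exact: measurable_Omega.
move=> kappaE.
have -> : \int[mu]_(x in Omega) bump x =
    \int[mu]_(x in Omega) u1 x - kappa * \int[mu]_(x in Omega) u2 x.
  rewrite -RintegralZl//; last exact: integrable_prob_Ck Cu2.
  rewrite -RintegralB//.
  - by apply: eq_Rintegral => x _; rewrite /bump /profile /u2 /u1 /=; ring.
  - exact: integrable_prob_Ck Cu1.
  - exact: (integrable_prob_Ck (CkZ kappa openT Cu2)).
have [I20|I20] := eqVneq (\int[mu]_(x in Omega) u2 x) 0; last first.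
  by rewrite kappaE divfK// subrr.
rewrite I20 mulr0 subr0.
have u2_ge0 x : Omega x -> 0 <= u2 x.
  move=> Ox; rewrite /u2 /u1 /= mulrA mulr_ge0//; first by rewrite -expr2 sqr_ge0.
  by rewrite /weight exprn_ge0 ?posp_ge0.
have ae2 : ae_eq mu Omega (EFin \o u2) (cst 0%E).
  apply: Rintegral_le0_ae_eq => //; last by rewrite I20.
  exact: integrable_prob_Ck Cu2.
rewrite /Rintegral (@ae_eq_integral _ _ _ _ _ (cst 0%E))//.
- by rewrite integral0.
- apply/measurable_EFinP; apply: (@Ck_measurable _ _ _ oOmega 2).
  by apply: Ck_subset Cu1.
- apply: filterS ae2 => x H Ox; have := H Ox; rewrite /= => -[].
  rewrite /u2 /= => /eqP; rewrite mulf_eq0 => /orP[/eqP r0|/eqP ->//].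
  by rewrite /u1 /= r0 mul0r.
Qed.

End mean.

End patch.

(** * The flux of a bump *)

Section flux_limit.
Variables (R : realType) (d : nat) (Omega : set 'rV[R]_d).
Local Notation V := 'rV[R]_d.
Local Notation lam := (lebesgue_rV R d).
Local Notation e i := (delta_mx 0 i : V).
Hypotheses (oOmega : open Omega) (bOmega : bounded_set Omega).

Lemma Ck1_comp (A : set V) (h h' : R -> R) (f : V -> R) : open A ->
  continuous h' -> (forall t : R, is_derive t 1 h (h' t)) -> Ck_on A 1 f ->
  Ck_on A 1 (h \o f) /\
  forall i x, A x -> partial i (h \o f) x = h' (f x) * partial i f x.
Proof.
move=> oA ch dh Cf.
have D i x : A x -> is_derive x (e i) (h \o f) (h' (f x) * partial i f x).
  by move=> Ax; apply: is_derive_chain; exact: is_derive_partial Cf Ax.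
have E i x : A x -> partial i (h \o f) x = h' (f x) * partial i f x.
  by move=> /(D i)[].
split=> //; split=> [x Ax|i].
  apply: (@continuous_comp _ _ _ f h); first exact: Ck_continuous Cf Ax.
  apply: differentiable_continuous; apply/derivable1_diffP.
  by have [] := dh (f x).
split=> [x Ax|]; first by have [] := D i x Ax.
apply: (@Ck_eq _ _ _ _ (fun x => h' (f x) * partial i f x)) => //.
  by move=> x /E.
split=> // x Ax; apply: (@continuousM _ _ (h' \o f) (partial i f)).
  by apply: continuous_comp; [exact: Ck_continuous Cf Ax|exact: ch].
exact: (Ck_continuous (Ck_partial i Cf) Ax).
Qed.

(** A sufficient condition for integrability on Omega that is stable under sums
    and products. *)
Definition tame (f : V -> R) := measurable_fun Omega f /\ bounded_on Omega f.

Lemma tame_integrable f : tame f -> lam.-integrable Omega (EFin \o f).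
Proof. by move=> [mf bf]; exact: integrable_bounded_on. Qed.

Lemma tameD f g : tame f -> tame g -> tame (f \+ g).
Proof.
by move=> [mf bf] [mg bg]; split; [exact: measurable_funD|exact: bounded_onD].
Qed.

Lemma tameM f g : tame f -> tame g -> tame (f \* g).
Proof.
by move=> [mf bf] [mg bg]; split; [exact: measurable_funM|exact: bounded_onM].
Qed.

Lemma tame_cst r : tame (cst r).
Proof. by split=> //; exists `|r|. Qed.

Lemma tame_sum (I : Type) (t : seq I) (F : I -> V -> R) :
  (forall j, tame (F j)) -> tame (fun x => \sum_(j <- t) F j x).
Proof.
move=> tF; split; first by apply: measurable_sum => j; case: (tF j).
by apply: bounded_on_sum => j; case: (tF j).
Qed.

Lemma tame_Ck n f : Ck_on setT n f -> tame f.
Proof.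
move=> Cf; split; last exact: Ck_bounded_on Cf.
by apply: (@Ck_measurable _ _ _ oOmega n); apply: Ck_subset Cf.
Qed.

Lemma Rintegral_tame_sum (I : Type) (t : seq I) (F : I -> V -> R) :
  (forall j, tame (F j)) -> \int[lam]_(x in Omega) (\sum_(j <- t) F j x) =
  \sum_(j <- t) \int[lam]_(x in Omega) F j x.
Proof.
move=> tF; elim: t => [|j t IH].
  rewrite big_nil /Rintegral integral0_eq// => x _; by rewrite big_nil.
rewrite big_cons -IH -RintegralD//.
- by apply: eq_Rintegral => x _; rewrite big_cons.
- exact: measurable_Omega.
- exact: tame_integrable.
- exact: (tame_integrable (tame_sum t tF)).
Qed.

Variables (k : 'I_d) (s : bool) (gamma nq : 'rV[R]_d.-1 -> R) (r kappa : R).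
Hypotheses (Cgamma : Ck_on setT 2 gamma) (Cnq : Ck_on setT 2 nq).
Local Notation rho := (rho k s gamma).
Local Notation window := (window k s gamma nq r).
Local Notation weight := (weight k s gamma nq r).
Local Notation profile := (profile k s gamma nq r kappa).
Local Notation bump := (bump k s gamma nq r kappa).

Hypothesis window_graph : forall x, 0 <= window x ->
  \forall y \near x, Omega y <-> 0 < rho y.

Let Crho : Ck_on setT 2 rho := Ck_rho k s Cgamma.
Let Cwindow : Ck_on setT 2 window := Ck_window k s r Cgamma Cnq.
Let Cweight : Ck_on setT 2 weight := Ck_weight k s r Cgamma Cnq.
Let Cprofile : Ck_on setT 2 profile := Ck_profile k s r kappa Cgamma Cnq.
Let Cbump : Ck_on setT 2 bump := Ck_bump k s r kappa Cgamma Cnq.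

(** For n > 0, it vanishes where rho <= 1 / n and is 1 where rho >= 3 / n. *)
Definition cut (n : nat) : V -> R := @ramp R \o (fun x => n%:R * rho x - 1).

(** The derivative of [cut n] with respect to rho. *)
Definition cut_slope (n : nat) (x : V) : R := tent (n%:R * rho x - 1) * n%:R.

Let C_arg n : Ck_on setT 1 (fun x => n%:R * rho x - 1).
Proof.
apply: CkB; [exact: openT| |exact: Ck_cst].
by apply: CkZ; [exact: openT|exact: CkS].
Qed.

Lemma Ck_cut n : Ck_on setT 1 (cut n).
Proof. exact: (Ck1_comp openT (@continuous_tent R) (@is_derive_ramp R) (C_arg n)).1. Qed.

Lemma partial_cut n i x : partial i (cut n) x = cut_slope n x * partial i rho x.
Proof.
rewrite (Ck1_comp openT (@continuous_tent R) (@is_derive_ramp R) (C_arg n)).2//.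
rewrite -mulrA; congr (_ * _).
have D := is_deriveB (is_deriveZ n%:R (is_derive_partial i (CkS Crho) (I : setT x)))
  (is_derive_cst (1 : R) x (e i)).
suff [_ E] : is_derive x (e i) (fun x => n%:R * rho x - 1) (n%:R * partial i rho x).
  exact: E.
by apply: (is_derive_eq D); rewrite subr0.
Qed.

Lemma compact_cut n :
  compact [set x | 0 <= window x /\ 1 <= n%:R * rho x] /\
  [set x | 0 <= window x /\ 1 <= n%:R * rho x] `<=` Omega.
Proof.
have KO : [set x | 0 <= window x /\ 1 <= n%:R * rho x] `<=` Omega.
  move=> x [/= w0 nr]; apply/(window_Omega window_graph w0).
  have : 0 < n%:R * rho x by apply: lt_le_trans nr.
  by case: n nr => [|n] nr; [rewrite mul0r ltxx|rewrite pmulr_rgt0].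
split=> //; apply: bounded_closed_compact.
  have [M [Mr MP]] := bOmega; exists M; split=> // N MN x /KO; exact: MP.
have -> : [set x | 0 <= window x /\ 1 <= n%:R * rho x] =
  (window @^-1` [set t | 0 <= t]) `&` ((fun x => n%:R * rho x - 1) @^-1` [set t | 0 <= t]).
  by apply/seteqP; split=> x /= [w0 H]; split=> //; move: H; rewrite subr_ge0.
apply: closedI; apply: closed_comp; try exact: closed_ge.
  by move=> x _; exact: Ck_continuous Cwindow I.
by move=> x _; exact: Ck_continuous (C_arg n) I.
Qed.

Lemma Rintegral_cut_eq0 n i (w : V -> R) : Ck_on Omega 1 w ->
  (forall x, window x < 0 -> w x = 0) ->
  \int[lam]_(x in Omega) partial i (cut n \* w) x = 0.
Proof.
move=> Cw w0; have [cK KO] := compact_cut n.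
have CcO : Ck_on Omega 1 (cut n) by apply: Ck_subset (Ck_cut n).
apply: (Rintegral_partial_eq0 _ _ i (CkM oOmega CcO Cw) cK KO) => // x Ox Kx.
have [wx|wx] := leP 0 (window x); last by rewrite /= w0// mulr0.
have [rx|rx] := leP 1 (n%:R * rho x); first by exfalso; apply: Kx.
by rewrite /= /cut /= ramp_le0 ?mul0r// subr_le0 ltW.
Qed.

Section limit.
Variables (a : V -> 'M[R]_d) (c : R).
Hypothesis a_C1 : forall i j, C1_closure Omega (fun x => a x i j).
Hypothesis c_gt0 : 0 < c.
Hypothesis a_elliptic : forall (xi : V) x, Omega x ->
  c * enorm xi ^+ 2 <= (xi *m a x *m xi^T) 0 0.

Let w i j (x : V) := a x i j * partial j bump x.
Let corr j (x : V) := partial j profile x - kappa * weight x * partial j rho x.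
Let err (x : V) := \sum_i \sum_j partial i rho x * (a x i j * corr j x).
(* The factor 6 comes from the derivative of the cube and that of the square of
   rho in the window, see partial_weight. *)
Let target (x : V) :=
  div_a_grad a bump x + 6 * c * (posp (window x) ^+ 2 * rho x).
Let lower n (x : V) := cut n x * target x + cut_slope n x * rho x * err x.
(* The second term replaces the boundary integral of weight by a volume
   integral. *)
Let total n (x : V) := \sum_i \sum_j partial i (cut n \* w i j) x -
  c * (-1) ^+ s * partial k (cut n \* weight) x.

Let tame_a i j : tame (fun x => a x i j).
Proof. by split; [exact: Ck_measurable (a_Ck a_C1 i j)|exact: a_bounded]. Qed.

Let CcutO n : Ck_on Omega 1 (cut n).
Proof. by apply: Ck_subset (Ck_cut n). Qed.

Let CweightO : Ck_on Omega 1 weight.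
Proof. by apply: Ck_subset (CkS Cweight). Qed.

Lemma tame_partial_cut n i (f : V -> R) : Ck_on Omega 1 f ->
  bounded_on Omega f -> bounded_on Omega (partial i f) ->
  tame (partial i (cut n \* f)).
Proof.
move=> Cf bf bdf; split.
  exact: (Ck_measurable oOmega (Ck_partial i (CkM oOmega (CcutO n) Cf))).
apply: partialM_bounded => //.
  exact: Ck_bounded_on (Ck_cut n).
exact: Ck_bounded_on (Ck_partial i (Ck_cut n)).
Qed.

Lemma tame_partial_cut_w n i j : tame (partial i (cut n \* w i j)).
Proof.
apply: tame_partial_cut; [exact: flux_Ck|exact: flux_bounded|].
exact: partial_flux_bounded.
Qed.

Lemma tame_partial_cut_weight n : tame (partial k (cut n \* weight)).
Proof.
apply: tame_partial_cut => //; first exact: Ck_bounded_on Cweight.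
exact: Ck_bounded_on (Ck_partial k Cweight).
Qed.

Lemma tame_total n : tame (total n).
Proof.
rewrite (_ : total n = (fun x => \sum_i \sum_j partial i (cut n \* w i j) x) \+
   (cst (- (c * (-1) ^+ s)) \* partial k (cut n \* weight))); last first.
  by apply/funext => x; rewrite /total /= mulNr.
apply: tameD.
  apply: tame_sum => i; apply: (@tame_sum _ _ (fun j => partial i (cut n \* w i j))) => j.
  exact: tame_partial_cut_w.
by apply: tameM; [exact: tame_cst|exact: tame_partial_cut_weight].
Qed.

Lemma Rintegral_total n : \int[lam]_(x in Omega) total n x = 0.
Proof.
have mO : measurable Omega by exact: measurable_Omega.
have ts : tame (fun x => \sum_i \sum_j partial i (cut n \* w i j) x).
  apply: tame_sum => i; apply: (@tame_sum _ _ (fun j => partial i (cut n \* w i j))) => j.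
  exact: tame_partial_cut_w.
rewrite /total RintegralB//; first last.
- apply: tame_integrable; apply: (@tameM (cst (c * (-1) ^+ s))); first exact: tame_cst.
  exact: tame_partial_cut_weight.
- exact: tame_integrable.
rewrite RintegralZl//; last exact: (tame_integrable (tame_partial_cut_weight n)).
rewrite Rintegral_cut_eq0//; last by move=> x /ltW; exact: weight_eq0.
rewrite mulr0 subr0 Rintegral_tame_sum; last first.
  move=> i; apply: (@tame_sum _ _ (fun j => partial i (cut n \* w i j))) => j.
  exact: tame_partial_cut_w.
rewrite big1// => i _; rewrite (@Rintegral_tame_sum _ _ (fun j => partial i (cut n \* w i j))).
  rewrite big1// => j _; apply: Rintegral_cut_eq0; first exact: flux_Ck.
  move=> x wx; have -> : w i j x = a x i j * 0.
    congr (_ * _); apply: (partial_locally0 Cgamma Cnq) wx => y.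
    exact: bump_eq0.
  exact: mulr0.
by move=> j; exact: tame_partial_cut_w.
Qed.

Lemma cut_slope_ge0 n x : 0 <= cut_slope n x.
Proof. by rewrite mulr_ge0//; have /andP[] := tent_itv (n%:R * rho x - 1). Qed.

(** The slope is at most n, and is nonzero only where n * rho < 3. *)
Lemma cut_slope_rho n x : 0 <= cut_slope n x * rho x <= 3.
Proof.
rewrite /cut_slope -mulrA; have /andP[t0 t1] := tent_itv (n%:R * rho x - 1).
have [h|h] := leP (n%:R * rho x - 1) 0; first by rewrite tent_le0// mul0r lexx ler0n.
have [h2|h2] := leP 2 (n%:R * rho x - 1); first by rewrite tent_ge2// mul0r lexx ler0n.
by apply/andP; split; nra.
Qed.

(** The difference is cut_slope * weight * (B - c), where B is the value of the
    quadratic form of a at the gradient of rho. Ellipticity gives B >= c, because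
    the component k of this gradient is 1 or -1. *)
Lemma lower_le_total n x : Omega x -> lower n x <= total n x.
Proof.
move=> Ox; have CwO i j : Ck_on Omega 1 (w i j) by exact: flux_Ck.
pose B := \sum_i \sum_j partial i rho x * (a x i j * partial j rho x).
have Bc : c <= B.
  have := a_elliptic (\row_j partial j rho x) Ox.
  rewrite (_ : (_ *m _ *m _) 0 0 = B); last first.
    rewrite mxE /B exchange_big; apply: eq_bigr => j _ /=.
    rewrite !mxE mulr_suml; apply: eq_bigr => i _.
    by rewrite !mxE mulrA.
  apply: le_trans; rewrite ler_pMr// /enorm sqr_sqrtr; last first.
    by apply: sumr_ge0 => j _; exact: sqr_ge0.
  rewrite (bigD1 k)//= mxE partial_rho// sqrr_sign lerDl.
  by apply: sumr_ge0 => j _; exact: sqr_ge0.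
have E1 : \sum_i \sum_j partial i (cut n \* w i j) x =
    cut_slope n x * (weight x * B + rho x * err x) + cut n x * div_a_grad a bump x.
  rewrite /B /err /div_a_grad !mulr_sumr -!big_split/= mulr_sumr.
  rewrite -big_split /=; apply: eq_bigr => i _.
  rewrite !mulr_sumr -!big_split/= mulr_sumr -big_split/=; apply: eq_bigr => j _.
  rewrite (partialM i (CcutO n) (CwO i j) Ox) partial_cut.
  by rewrite /w /corr (partial_bump k s r kappa Cgamma Cnq); ring.
rewrite /lower /total E1 (partialM k (CcutO n) CweightO Ox) partial_cut.
rewrite (partial_weight k s r Cgamma Cnq) partial_rho// /target.
have s2 : (-1) ^+ s * (-1) ^+ s = 1 :> R by rewrite -expr2 sqrr_sign.
have -> : c * (-1) ^+ s * (cut_slope n x * (-1) ^+ s * weight x + cut n x *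
   - (6 * posp (window x) ^+ 2 * rho x * (-1) ^+ s)) =
   ((-1) ^+ s * (-1) ^+ s) * (c * cut_slope n x * weight x -
     c * cut n x * (6 * posp (window x) ^+ 2 * rho x)) by ring.
rewrite s2 mul1r -subr_ge0.
have -> : cut_slope n x * (weight x * B + rho x * err x) + cut n x * div_a_grad a bump x -
  (c * cut_slope n x * weight x - c * cut n x * (6 * posp (window x) ^+ 2 * rho x)) -
  (cut n x * (div_a_grad a bump x + 6 * c * (posp (window x) ^+ 2 * rho x)) +
   cut_slope n x * rho x * err x) = cut_slope n x * weight x * (B - c) by ring.
by apply: mulr_ge0; [apply: mulr_ge0; [exact: cut_slope_ge0|exact: weight_ge0]|rewrite subr_ge0].
Qed.

Lemma tame_err : tame err.
Proof.
apply: tame_sum => i.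
apply: (@tame_sum _ _ (fun j => partial i rho \* ((fun x => a x i j) \* corr j))) => j.
apply: tameM; first exact: tame_Ck (Ck_partial i Crho).
apply: tameM => //; apply: (@tame_Ck 1); apply: CkB; [exact: openT|exact: Ck_partial|].
apply: (@CkM _ _ _ _ (fun x => kappa * weight x)); [exact: openT| |exact: Ck_partial].
by apply: CkZ; [exact: openT|exact: CkS].
Qed.

Lemma tame_excess : tame (fun x => posp (window x) ^+ 2 * rho x).
Proof.
apply: (@tameM (fun x => posp (window x) ^+ 2)); last exact: tame_Ck Crho.
by apply: (@tame_Ck 1); apply: Ck_pospX => //; [exact: openT|exact: CkS].
Qed.

Lemma tame_target : tame target.
Proof.
apply: tameD; last by apply: (@tameM (cst (6 * c))); [exact: tame_cst|exact: tame_excess].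
by split; [exact: div_a_grad_measurable|exact: div_a_grad_bounded].
Qed.

Lemma continuous_cut_slope n : continuous (fun x => cut_slope n x * rho x).
Proof.
move=> x; apply: (@continuousM _ _ (cut_slope n) rho); last exact: Ck_continuous Crho I.
apply: (@continuousM _ _ (fun x => tent (n%:R * rho x - 1)) (cst n%:R));
  last exact: cst_continuous.
apply: (@continuous_comp _ _ _ (fun x => n%:R * rho x - 1) (@tent R)).
  exact: Ck_continuous (C_arg n) I.
exact: continuous_tent.
Qed.

Lemma tame_lower n : tame (lower n).
Proof.
apply: tameD; first by apply: tameM; [exact: tame_Ck (Ck_cut n)|exact: tame_target].
apply: (@tameM (fun x => cut_slope n x * rho x)); last exact: tame_err.
split; last by apply: continuous_bounded_on => //; exact: continuous_cut_slope.
by apply: measurable_funTS; apply: rV_continuous_measurable; exact: continuous_cut_slope.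
Qed.

Lemma lower_bounded : exists K : R, forall n x, Omega x -> `|lower n x| <= K.
Proof.
have [_ [K HK]] := tame_target; have [_ [L HL]] := tame_err.
exists (K + 3 * L) => n x Ox; rewrite (le_trans (ler_normD _ _))//.
have /andP[c0 c1] := ramp_itv (n%:R * rho x - 1).
have /andP[p0 p1] := cut_slope_rho n x.
have c2 : `|cut n x| <= 1 by rewrite ger0_norm.
have p2 : `|cut_slope n x * rho x| <= 3 by rewrite ger0_norm.
apply: lerD; last first.
  by rewrite normrM; apply: ler_pM; [exact: normr_ge0..|exact: p2|exact: HL].
rewrite -[leRHS]mul1r normrM.
by apply: ler_pM; [exact: normr_ge0..|exact: c2|exact: HK].
Qed.

(** Inside the window rho is positive on Omega, so that the cutoff is eventually 1
    and its slope 0; outside of the window the bump vanishes identically. *)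
Lemma lower_cvg x : Omega x -> lower n x @[n --> \oo] --> target x.
Proof.
move=> Ox; apply: cvg_near_cst; rewrite /lower.
have [wx|wx] := leP 0 (window x).
  have rx : 0 < rho x by apply/(window_Omega window_graph wx).
  near=> n.
  have n3 : 2 <= n%:R * rho x - 1.
    rewrite lerBrDr -ler_pdivrMr//; near: n; exact: nbhs_infty_ger.
  by rewrite /cut /cut_slope /= ramp_ge2// tent_ge2// !mul0r mul1r addr0.
have E0 : err x = 0.
  rewrite /err big1// => i _; rewrite big1// => j _; rewrite /corr.
  rewrite weight_eq0 ?ltW// mulr0 mul0r subr0.
  have -> : partial j profile x = 0.
    by apply: (partial_locally0 Cgamma Cnq) wx => y; exact: profile_eq0.
  by rewrite !mulr0.
have T0 : target x = 0.
  rewrite /target posp_eq0 ?ltW// expr0n mul0r mulr0 addr0.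
  rewrite /div_a_grad big1// => i _; rewrite big1// => j _.
  rewrite (@partial_near_eq _ _ _ _ (cst 0)); first by rewrite /partial derive_cst.
  apply: filterS (near_window_lt0 Cgamma Cnq wx) => y wy.
  have -> : partial j bump y = 0.
    by apply: (partial_locally0 Cgamma Cnq) wy => z; exact: bump_eq0.
  by rewrite mulr0.
by apply: nearW => n; rewrite E0 T0 !mulr0 addr0.
Unshelve. all: by end_near. Qed.

(** Dominated convergence: [target] is the limit of [lower n], which is at most
    [total n], a sum of partial derivatives of functions with compact support in
    Omega. *)
Lemma Rintegral_target_le0 : \int[lam]_(x in Omega) target x <= 0.
Proof.
have mO : measurable Omega by exact: measurable_Omega.
have [K HK] := lower_bounded.
have [||||| itarget _ cvgI] := @dominated_convergence _ _ R lam Omega mO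
  (fun n => EFin \o lower n) (EFin \o target) (EFin \o cst K).
- by move=> n; apply/measurable_EFinP; exact: (tame_lower n).1.
- by apply/measurable_EFinP; exact: tame_target.1.
- by apply: aeW => x Ox; apply: cvg_EFin; [exact: nearW|exact: lower_cvg].
- exact: tame_integrable (tame_cst K).
- by apply: aeW => x n Ox; rewrite lee_fin; exact: HK.
rewrite -lee_fin /Rintegral fineK ?integrable_fin_num//.
apply: (cvge_to_le cvgI); apply: nearW => n.
apply: (@le_trans _ _ (\int[lam]_(x in Omega) lower n x)%:E).
  by rewrite /Rintegral fineK// integrable_fin_num//; exact: tame_integrable (tame_lower n).
rewrite lee_fin -[leRHS](Rintegral_total n); apply: le_Rintegral => //.
- exact: tame_integrable (tame_lower n).
- exact: tame_integrable (tame_total n).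
- by move=> x Ox; exact: lower_le_total.
Qed.

(** If the integral were 0 then the second term of [target], nonnegative and
    continuous on Omega, would have integral at most 0, and would therefore
    vanish on an open set where it is positive. *)
Lemma Rintegral_div_bump_neq0 :
  (exists2 x, Omega x & 0 < window x) ->
  \int[lam]_(x in Omega) div_a_grad a bump x <> 0.
Proof.
move=> [x0 Ox0 wx0] div0.
have mO : measurable Omega by exact: measurable_Omega.
have := Rintegral_target_le0; rewrite /target RintegralD//; first last.
- apply: tame_integrable; apply: (@tameM (cst (6 * c))); first exact: tame_cst.
  exact: tame_excess.
- apply: tame_integrable.
  by split; [exact: div_a_grad_measurable|exact: div_a_grad_bounded].
rewrite div0 add0r RintegralZl//; last exact: tame_integrable tame_excess.
rewrite pmulr_rle0 ?mulr_gt0// => I0.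
have ae0 := Rintegral_le0_ae_eq mO (tame_integrable tame_excess).
have {ae0} : ae_eq lam Omega (EFin \o (fun x => posp (window x) ^+ 2 * rho x)) (cst 0%E).
  apply: ae0 => // x Ox; have [wx|wx] := leP 0 (window x); last first.
    by rewrite (posp_eq0 (ltW wx)) expr0n mul0r.
  by apply: mulr_ge0; [exact/exprn_ge0/posp_ge0|
    apply: ltW; apply/(window_Omega window_graph wx)].
move=> [N [mN N0 HN]].
have /nbhs_ballP[eps eps0 epsN] : \forall y \near x0, Omega y /\ 0 < window y.
  apply: filterI; first exact: open_nbhs_nbhs.
  have cw : {for x0, continuous window} by exact: Ck_continuous Cwindow I.
  exact: (cw _ (lt_nbhsr wx0)).
have : (lam (ball x0 eps) <= lam N)%E.
  apply: le_measure; rewrite ?inE//.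
    by apply: rV_open_measurable; exact: ball_open.
  move=> y /epsN [Oy wy]; apply: HN => /= H; have := H Oy.
  have ry : 0 < rho y by apply/(window_Omega window_graph (ltW wy)).
  move=> [] /eqP; rewrite mulf_eq0 expf_eq0/= posp_id ?ltW//.
  by rewrite (gt_eqF wy) (gt_eqF ry).
by rewrite N0 lebesgue_ball// lee_fin leNgt exprn_gt0// mulrn_wgt0.
Qed.

End limit.
End flux_limit.

(** * Localization at a boundary point *)

(** Otherwise Omega would be compact and a coordinate function would attain its
    maximum on it, which is impossible on an open set. *)
Lemma bnd_nonempty (R : realType) (d : nat) (i0 : 'I_d) (Omega : set 'rV[R]_d) :
  open Omega -> bounded_set Omega -> Omega !=set0 -> bnd Omega !=set0.
Proof.
move=> oO bO O0; apply: contrapT => b0.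
have cO : closed Omega.
  move=> x clx; apply: contrapT => nOx; apply: b0; exists x; split=> // nx.
  by apply: nOx; exact: nbhs_singleton nx.
have coord : continuous (fun x : 'rV[R]_d => x 0 i0).
  by move=> x; exact: coord_continuous.
have [x Ox xmax] := EVT_max_rV O0 (bounded_closed_compact bO cO)
  (continuous_subspaceT coord).
have /nbhs_ballP[eps /= eps0 xO] : nbhs x Omega.
  by apply: open_nbhs_nbhs; split=> //; exact/set_mem.
have := xmax (x + (eps / 2) *: delta_mx 0 i0).
have -> : (x + (eps / 2) *: delta_mx 0 i0) 0 i0 = x 0 i0 + eps / 2.
  by rewrite !mxE !eqxx mulr1.
rewrite gerDl leNgt divr_gt0// => H; suff: false by []; apply: H.
rewrite inE; apply: xO; split=> // i j; rewrite /ball /= !mxE opprD addNKr normrN.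
rewrite normrM gtr0_norm ?divr_gt0// (@le_lt_trans _ _ (eps / 2))//; last by lra.
by rewrite ger_pMr ?divr_gt0//; case: (_ && _); rewrite ?normr1 ?normr0.
Qed.

(** The height vanishes at x0, and gamma is continuous, so that the points with
    small height over a neighbourhood of the projection of x0 are close to x0;
    hence a window of small radius lies where Omega is the set rho > 0. *)
Lemma small_patch (R : realType) (d : nat) (Omega : set 'rV[R]_d)
    (k : 'I_d) (s : bool) (gamma : 'rV[R]_d.-1 -> R) (x0 : 'rV[R]_d) :
  open Omega -> bnd Omega x0 -> Ck_on setT 2 gamma ->
  (\forall x \near x0, Omega x <-> 0 < rho k s gamma x) ->
  exists (nq : 'rV[R]_d.-1 -> R) (r : R), [/\ Ck_on setT 2 nq,
    forall x, 0 <= window k s gamma nq r x ->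
      \forall y \near x, Omega y <-> 0 < rho k s gamma y &
    exists2 x, Omega x & 0 < window k s gamma nq r x].
Proof.
move=> oO [clx0 nx0] Cg /nbhs_ballP[eps /= eps0 H].
have cr : continuous (rho k s gamma) by exact: continuous_rho.
have r0 : rho k s gamma x0 = 0.
  have Hx0 := H x0 (ballxx x0 eps0).
  have nOx0 : ~ Omega x0 by move=> Ox; apply: nx0; exact: open_nbhs_nbhs.
  apply/eqP; rewrite eq_le; apply/andP; split.
    by rewrite leNgt; apply/negP => /Hx0.
  rewrite leNgt; apply/negP => rx.
  have [y [Oy [yx yr]]] := clx0 _ (filterI (nbhsx_ballx x0 eps eps0)
    (cr x0 _ (lt_nbhsl rx))).
  by have := (H y yx).1 Oy; rewrite ltNge ltW.
have cg : {for col' k x0, continuous gamma} by exact: Ck_continuous Cg I.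
have e20 : 0 < eps / 2 by rewrite divr_gt0.
have /nbhs_ballP[del /= del0 Hdel] := cg _ (nbhsx_ballx (gamma (col' k x0)) _ e20).
(* The coordinate k of x - x0 is the height plus an increment of gamma; each of
   the two is at most eps / 2. *)
pose r := Num.min (eps / 2) (del / 2).
have rpos : 0 < r by rewrite lt_min e20 divr_gt0.
pose nq := fun y : 'rV[R]_d.-1 => \sum_j (y 0 j - col' k x0 0 j) ^+ 2.
have Cnq : Ck_on setT 2 nq.
  apply: Ck_sum => [|j]; first exact: openT.
  have C1 : Ck_on setT 2 (fun y : 'rV[R]_d.-1 => y 0 j - col' k x0 0 j).
    by apply: CkB; [exact: openT|exact: Ck_coord|exact: Ck_cst].
  exact: (CkM openT C1 C1).
exists nq, r; split=> //.
  move=> x wx; suff xB : ball x0 eps x.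
    have oB : open (ball x0 eps) by exact: ball_open.
    by apply: filterS (open_nbhs_nbhs (conj oB xB)) => y /H.
  have nq0 y : 0 <= nq y by apply: sumr_ge0 => j _; exact: sqr_ge0.
  have rho_r : `|rho k s gamma x| <= r.
    rewrite -(ger0_norm (ltW rpos)) -ler_sqr ?nnegrE// !real_normK ?num_real//.
    by move: wx (nq0 (col' k x)); rewrite /window; lra.
  have col_r j : `|x 0 (lift k j) - x0 0 (lift k j)| <= r.
    rewrite -(ger0_norm (ltW rpos)) -ler_sqr ?nnegrE// !real_normK ?num_real//.
    have : (x 0 (lift k j) - x0 0 (lift k j)) ^+ 2 <= nq (col' k x).
      rewrite /nq (bigD1 j)//= !mxE lerDl.
      by apply: sumr_ge0 => i _; exact: sqr_ge0.
    by move: wx (sqr_ge0 (rho k s gamma x)); rewrite /window; lra.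
  have r_eps : r <= eps / 2 by rewrite ge_min lexx.
  have r_del : r < del.
    by rewrite (@le_lt_trans _ _ (del / 2))// ?ge_min ?lexx ?orbT//; lra.
  have gx : `|gamma (col' k x0) - gamma (col' k x)| < eps / 2.
    apply: (Hdel (col' k x)); split=> // i j; rewrite !ord1 !mxE.
    by rewrite /ball /= distrC (le_lt_trans (col_r j)).
  split=> // i j; rewrite !ord1 /ball /= distrC.
  have [l ->|->] := unliftP k j.
    by rewrite (le_lt_trans (col_r l)) // (le_lt_trans r_eps)//; lra.
  have E : (-1) ^+ s * (x 0 k - x0 0 k) =
    rho k s gamma x - (gamma (col' k x0) - gamma (col' k x)).
    by move: r0; rewrite /rho => r0; lra.
  have -> : `|x 0 k - x0 0 k| = `|(-1) ^+ s * (x 0 k - x0 0 k)|.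
    by rewrite normrM normr_sign mul1r.
  rewrite E (le_lt_trans (ler_normB _ _))//; lra.
have wx0 : 0 < window k s gamma nq r x0.
  rewrite /window r0 /nq big1 ?expr0n ?subr0 ?exprn_gt0// => j _.
  by rewrite subrr expr0n.
have cw := @continuous_window R d k s gamma nq r Cg Cnq x0.
have [x [Ox wx]] := clx0 _ (cw _ (lt_nbhsr wx0)).
by exists x.
Qed.

Unset Implicit Arguments.

Theorem proposition2p8 (R : realType) (d : nat) (hd : (2 <= d)%N)
    (Omega : set 'rV[R]_d)
    (Omega_open : open Omega) (Omega_bounded : bounded_set Omega)
    (Omega_connected : connected Omega) (Omega_C2 : C2_domain Omega)
    (a : 'rV[R]_d -> 'M[R]_d)
    (a_sym : forall x, Omega x -> (a x)^T = a x)
    (a_C1 : forall i j, C1_closure Omega (fun x => a x i j))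
    (c : R) (c_gt0 : 0 < c)
    (a_elliptic : forall (xi : 'rV[R]_d) x, Omega x ->
       c * enorm xi ^+ 2 <= (xi *m a x *m xi^T) 0 0)
    (mu : probability 'rV[R]_d R)
    (mu_radon : radon mu) (mu_Omega : mu Omega = 1%E)
    (mu_continuous : mean_H2_continuous Omega mu) :
  ~ self_adjoint Omega (H_mu Omega a mu).
Proof.
move=> sa.
have O0 : Omega !=set0.
  apply/set0P/eqP => O0; move: mu_Omega; rewrite O0 measure0 => /eqP.
  by rewrite eq_sym onee_eq0.
have [x0 bx0] : bnd Omega !=set0.
  exact: (bnd_nonempty (Ordinal (ltnW hd))).
have [k [s [gamma [Cg near_x0]]]] := Omega_C2 x0 bx0.
have graph0 : \forall x \near x0, Omega x <-> 0 < rho k s gamma x.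
  by apply: filterS near_x0 => x; rewrite /rho subr_gt0.
have [nq [r [Cnq graph wpos]]] := small_patch Omega_open bx0 Cg graph0.
pose u1 := rho k s gamma \* weight k s gamma nq r.
pose kappa := (\int[mu]_(x in Omega) u1 x) /
  (\int[mu]_(x in Omega) (rho k s gamma \* u1) x).
pose u := bump k s gamma nq r kappa.
have Cu : Ck_on setT 2 u by exact: Ck_bump.
have mean0 : \int[mu]_(x in Omega) u x = 0 by exact: bump_mean_eq0.
have u_bnd x : bnd Omega x -> u x = \int[mu]_(x in Omega) u x.
  by rewrite mean0; exact: bump_bnd.
have := Rintegral_div_bump_neq0 Omega_open Omega_bounded Cg Cnq graph a_C1 c_gt0 a_elliptic wpos.
apply.
exact: (self_adjoint_Rintegral_eq0 Omega_open Omega_bounded a_C1 mu_Omega sa Cu u_bnd).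
Qed.
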